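(* Let $\Omega,T,F,f,L,S$ and the time-filtered scheme (with all physical parameters equal to $1$) be as in the context. For all $\Delta t>0$, assume that the condition $\max_{\phi\in\mathbb{R}}|f'(\phi)|\le L$ is satisfied, with $S\ge 3L/\Delta t$. For $0\le n\le N-1$ define $$ \begin{aligned} E^{n+1}:=&\ \tfrac14\left(\|\nabla\phi^{n+1}\|^2+\|\nabla(2\phi^{n+1}-\phi^n)\|^2+\|\nabla(\phi^{n+1}-\phi^n)\|^2\right)\\ &+\tfrac14\left(\|\boldsymbol{u}^{n+1}\|^2+\|2\boldsymbol{u}^{n+1}-\boldsymbol{u}^n\|^2+\|\boldsymbol{u}^{n+1}-\boldsymbol{u}^n\|^2\right)+3L\,\|\phi^{n+1}-\phi^n\|^2\\ &+\left(F(\phi^{n+1}),1\right)+\tfrac12\left(F(\phi^{n+1})-F(\phi^n),1\right). \end{aligned} $$ Then, for given $\phi^0,\phi^1,\mu^0,\mu^1,\boldsymbol{u}^0,\boldsymbol{u}^1$ and $p^1$, there exists a positive constant $C_0$ such that $E^1\le C_0$, and the scheme satisfies $$E^{n+1}-E^n\le 0\qquad\text{for all } 1\le n\le N-1 .$$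
   Context: $\Omega\subset\mathbb{R}^d$ ($d=2,3$) is a bounded convex polygonal or polyhedral domain, $T>0$, $N\ge 2$ is an integer, $\Delta t=T/N$, $t_n=n\Delta t$. $(\cdot,\cdot)$ and $\|\cdot\|$ are the $L^2(\Omega)$ inner product and norm. $X=H^1(\Omega)$, $\boldsymbol{Y}=H_0^1(\Omega)^d$, $Q=L_0^2(\Omega)$ (mean-zero $L^2$ functions). Potential: $f(\phi)=\phi^3-\phi=F'(\phi)$. $L$ is a positive constant, for which the condition $\max_{\phi\in\mathbb{R}}|f'(\phi)|\le L$ is assumed to hold, and $S$ is the stabilization parameter. Notation: for a sequence $\{s^n\}$, $$\mathcal{A}(s^{n+1})=\tfrac32 s^{n+1}-2s^n+\tfrac12 s^{n-1},\qquad \mathcal{B}(s^{n+1})=\tfrac32 s^{n+1}-s^n+\tfrac12 s^{n-1},\qquad \bar s^{n+1}=2s^n-s^{n-1}.$$ Time-filtered scheme (semi-implicit backward Euler with time filtering for the Cahn–Hilliard–Navier–Stokes system, with mobility, interfacial width, viscosity and surface tension parameters $M=\epsilon=\nu=\gamma=1$): given the starting values at levels $0$ and $1$, for $n=1,\dots,N-1$ find $(\tilde\phi^{n+1},\tilde\mu^{n+1},\tilde{\boldsymbol{u}}^{n+1},\tilde p^{n+1})\in X\times X\times\boldsymbol{Y}\times Q$ such that for all $(\psi,\omega,\boldsymbol{v},q)\in X\times X\times\boldsymbol{Y}\times Q$ $$ \begin{aligned} &\tfrac1{\Delta t}(\tilde\phi^{n+1}-\phi^n,\psi)+(\tilde{\boldsymbol{u}}^{n+1}\cdot\nabla\bar\phi^{n+1},\psi)+(\nabla\tilde\mu^{n+1},\nabla\psi)=0,\\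 &-(\tilde\mu^{n+1},\omega)+(\nabla\tilde\phi^{n+1},\nabla\omega)+S\Delta t(\tilde\phi^{n+1}-\phi^n,\omega)+(2f(\phi^n)-f(\phi^{n-1}),\omega)=0,\\ &\tfrac1{\Delta t}(\tilde{\boldsymbol{u}}^{n+1}-\boldsymbol{u}^n,\boldsymbol{v})+(\nabla\tilde{\boldsymbol{u}}^{n+1},\nabla\boldsymbol{v})+((\bar{\boldsymbol{u}}^{n+1}\cdot\nabla)\tilde{\boldsymbol{u}}^{n+1},\boldsymbol{v})-(\tilde p^{n+1},\nabla\cdot\boldsymbol{v})-(\tilde\mu^{n+1}\nabla\bar\phi^{n+1},\boldsymbol{v})=0,\\ &(\nabla\cdot\tilde{\boldsymbol{u}}^{n+1},q)=0, \end{aligned} $$ and then set $s^{n+1}=\tilde s^{n+1}-\tfrac13(\tilde s^{n+1}-2s^n+s^{n-1})$ for $s=\phi,\mu,\boldsymbol{u}$, and either the same formula for $p$ (Option A, which also uses a starting pressure $p^0$) or $p^{n+1}=\tilde p^{n+1}$ (Option B). For each filtered variable, equivalently $\tilde s^{n+1}=\mathcal{B}(s^{n+1})$ and $\tilde s^{n+1}-s^n=\mathcal{A}(s^{n+1})$.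
   Formalization: Since max|f'| ≤ L fails for the cubic on the whole line, f may be any differentiable function with |f'| ≤ L equal to φ³−φ on [−K,K], K ≥ 1 (F a primitive), and the starting velocities u⁰, u¹ are assumed divergence-free, without which the energy can grow. *)

(* Defs.v *)
From HB Require Import structures.
From mathcomp Require Import all_boot all_order all_algebra.
From mathcomp Require Import all_classical all_reals all_analysis.

Set Implicit Arguments.
Unset Strict Implicit.
Unset Printing Implicit Defensive.

Import Order.TTheory GRing.Theory Num.Theory.
Import numFieldNormedType.Exports.

Local Open Scope classical_set_scope.
Local Open Scope ring_scope.

Definition rV_display : measure_display. Proof. exact. Qed.

(* The product sigma-algebra on R^n, generated by the coordinates. *)
Section measurable_rV.
Context {R : realType} {n : nat}.

Let coors : 'I_n -> 'rV[R]_n -> measurableTypeR R := fun i x => x ord0 i.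

Let rV_set0 : g_sigma_preimage coors set0.
Proof. exact: sigma_algebra0. Qed.

Let rV_setC A : g_sigma_preimage coors A -> g_sigma_preimage coors (~` A).
Proof. exact: sigma_algebraC. Qed.

Let rV_bigcup (F : (set 'rV[R]_n)^nat) :
  (forall i, g_sigma_preimage coors (F i)) ->
  g_sigma_preimage coors (\bigcup_i (F i)).
Proof. exact: sigma_algebra_bigcup. Qed.

HB.instance Definition _ := @isMeasurable.Build rV_display
  'rV[R]_n (g_sigma_preimage coors) rV_set0 rV_setC rV_bigcup.

Lemma measurable_coord (i : 'I_n) :
  measurable_fun [set: 'rV[R]_n] (fun x : 'rV[R]_n => x ord0 i : measurableTypeR R).
Proof.
move=> _ Y mY; rewrite setTI; apply: sub_sigma_algebra => /=.
rewrite -bigcup_seq/=; exists i => /=; first by rewrite mem_index_enum.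
by exists Y => //; rewrite setTI.
Qed.

Lemma measurable_fun_rV d (T : measurableType d) (f : T -> 'rV[R]_n) :
  (forall i, measurable_fun [set: T] (fun t => f t ord0 i : measurableTypeR R)) ->
  measurable_fun [set: T] f.
Proof.
move=> mf.
suff : g_sigma_preimage (fun i => coors i \o f) `<=` measurable.
  by rewrite g_sigma_preimage_comp => prefS _ A mA; apply: prefS; exists A.
apply: smallest_sub; first exact: sigma_algebra_measurable.
rewrite -bigcup_seq; apply: bigcup_sub => i _ A [B mB <-]; exact: mf.
Qed.

End measurable_rV.

Section lebesgue_rV.
Context {R : realType}.

Definition cons_rV n (p : measurableTypeR R * 'rV[R]_n) : 'rV[R]_n.+1 :=
  row_mx (p.1 : R)%:M p.2.

Lemma cons_rV0 n p : @cons_rV n p ord0 ord0 = p.1.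
Proof.
rewrite /cons_rV.
have -> : ord0 = lshift n (ord0 : 'I_1) by exact/val_inj.
by rewrite (@row_mxEl _ 1 1 n) mxE.
Qed.

Lemma cons_rVS n p i : @cons_rV n p ord0 (lift ord0 i) = p.2 ord0 i.
Proof.
rewrite /cons_rV.
have -> : lift ord0 i = rshift 1 i by exact/val_inj.
by rewrite (@row_mxEr _ 1 1 n).
Qed.

Lemma measurable_cons_rV n : measurable_fun setT (@cons_rV n).
Proof.
apply: measurable_fun_rV => i; case: (unliftP ord0 i) => [j ->|->].
- under eq_fun do rewrite cons_rVS.
  apply: (@measurableT_comp _ _ _ _ _ _ (fun x : 'rV[R]_n => x ord0 j : measurableTypeR R)).
    exact: measurable_coord.
  exact: measurable_snd.
- under eq_fun do rewrite cons_rV0.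
  exact: measurable_fst.
Qed.

HB.instance Definition _ n :=
  isMeasurableFun.Build _ _ _ _ (@cons_rV n) (@measurable_cons_rV n).

Definition uncons_rV n (x : 'rV[R]_n.+1) : measurableTypeR R * 'rV[R]_n :=
  (x ord0 ord0 : measurableTypeR R, \row_j x ord0 (lift ord0 j)).

Lemma cons_rVK n : cancel (@cons_rV n) (@uncons_rV n).
Proof.
move=> [a v]; rewrite /uncons_rV cons_rV0; congr pair.
by apply/rowP => j; rewrite mxE cons_rVS.
Qed.

Lemma measurable_uncons_rV n : measurable_fun setT (@uncons_rV n).
Proof.
apply/measurable_fun_pair; first exact: measurable_coord.
apply: measurable_fun_rV => i; under eq_fun do rewrite mxE.
exact: measurable_coord.
Qed.

Section succ.
Context n (mu : {sigma_finite_measure set 'rV[R]_n -> \bar R}).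

Definition lebesgue_rV_succ : set 'rV[R]_n.+1 -> \bar R :=
  pushforward (@lebesgue_measure R \x mu)%E (@cons_rV n).

Let succ0 : lebesgue_rV_succ set0 = 0%E.
Proof. exact: measure0. Qed.

Let succ_ge0 A : (0 <= lebesgue_rV_succ A)%E.
Proof. exact: measure_ge0. Qed.

Let succ_sigma_additive : semi_sigma_additive lebesgue_rV_succ.
Proof. exact: measure_semi_sigma_additive. Qed.

HB.instance Definition _ := isMeasure.Build _ _ _ lebesgue_rV_succ
  succ0 succ_ge0 succ_sigma_additive.

Let succ_sigma_finite : sigma_finite setT lebesgue_rV_succ.
Proof.
have /sigma_finiteP[F [TF ndF Foo]] := sigma_finiteT (@lebesgue_measure R).
have /sigma_finiteP[G [TG ndG Goo]] := sigma_finiteT mu.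
exists (fun k => @uncons_rV n @^-1` (F k `*` G k)).
  rewrite -preimage_bigcup (_ : \bigcup_k _ = setT) ?preimage_setT//.
  apply/seteqP; split => // -[x y] _.
  have [k _ Fkx] : (\bigcup_k F k) x by rewrite -TF.
  have [l _ Gly] : (\bigcup_k G k) y by rewrite -TG.
  exists (maxn k l) => //; split => /=.
    by move: x Fkx; exact/subsetPset/ndF/leq_maxl.
  by move: y Gly; exact/subsetPset/ndG/leq_maxr.
move=> k; have [mF Fk] := Foo k; have [mG Gk] := Goo k; split.
  rewrite -[X in measurable X]setTI; apply: measurable_uncons_rV => //.
  exact: measurableX.
rewrite /lebesgue_rV_succ /pushforward -comp_preimage.
rewrite (_ : _ \o _ = id); last by apply/funext => p /=; rewrite cons_rVK.
rewrite preimage_id product_measure1E// lte_mul_pinfty// ge0_fin_numE//.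
Qed.

HB.instance Definition _ := Measure_isSigmaFinite.Build _ _ _ lebesgue_rV_succ
  succ_sigma_finite.

End succ.

Let lebesgue_rV0 : {sigma_finite_measure set 'rV[R]_0 -> \bar R} :=
  dirac (0 : 'rV[R]_0).

(* Lebesgue measure on R^(n+1) is the image of the product of the Lebesgue
   measures on R and R^n; lebesgue_rV_box computes it on boxes. *)
Fixpoint lebesgue_rV n : {sigma_finite_measure set 'rV[R]_n -> \bar R} :=
  match n with
  | 0 => lebesgue_rV0
  | m.+1 => lebesgue_rV_succ (lebesgue_rV m)
  end.

Lemma lebesgue_rV_box n (a b : 'rV[R]_n) : (forall i, a ord0 i <= b ord0 i) ->
  lebesgue_rV n [set x : 'rV[R]_n | forall i, x ord0 i \in `]a ord0 i, b ord0 i[] =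
  (\prod_(i < n) (b ord0 i - a ord0 i))%:E.
Proof.
elim: n a b => [|n IH] a b ab /=.
  rewrite big_ord0 /dirac indicE mem_set //= => -[] //.
rewrite /lebesgue_rV_succ /pushforward.
set P := (X in (_ \x _)%E X).
pose a' : 'rV[R]_n := \row_j a ord0 (lift ord0 j).
pose b' : 'rV[R]_n := \row_j b ord0 (lift ord0 j).
pose I : set (measurableTypeR R) := `]a ord0 ord0, b ord0 ord0[%classic.
pose B : set 'rV[R]_n :=
  [set x : 'rV[R]_n | forall i, x ord0 i \in `]a' ord0 i, b' ord0 i[].
have -> : P = I `*` B.
  apply/seteqP; split => -[t v] /= h.
    split => [|i]; first by have := h ord0; rewrite cons_rV0.
    by rewrite !mxE; have := h (lift ord0 i); rewrite cons_rVS.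
  move=> i; case: (unliftP ord0 i) => [j ->|->].
    by rewrite cons_rVS; have := h.2 j; rewrite !mxE.
  by rewrite cons_rV0; exact: h.1.
rewrite product_measure1E; last 2 first.
- exact: measurable_itv.
- rewrite (_ : B = \bigcap_(i : 'I_n)
     ((fun x : 'rV[R]_n => x ord0 i : measurableTypeR R) @^-1`
        `]a' ord0 i, b' ord0 i[%classic)); last first.
    by apply/seteqP; split => x /= h i => [_|]; exact: h.
  apply: fin_bigcap_measurable => // i _.
  by rewrite -[X in measurable X]setTI; apply: measurable_coord => //; exact: measurable_itv.
rewrite [X in (X * _)%E = _]lebesgue_measure_itv /= lte_fin.
have -> : (if a ord0 ord0 < b ord0 ord0 then ((b ord0 ord0)%:E - (a ord0 ord0)%:E)%E else 0%E)
  = (b ord0 ord0 - a ord0 ord0)%:E.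
  by case: ltgtP (ab ord0) => // -> _; rewrite subrr.
rewrite [X in (_ * X)%E = _]IH; last by move=> i; rewrite !mxE.
by rewrite big_ord_recl -EFinM; congr (_ * _)%:E; apply: eq_bigr => i _; rewrite !mxE.
Qed.

End lebesgue_rV.

Section domain.
Context {R : realType} {d : nat}.
Implicit Types Omega : set 'rV[R]_d.

(* An intersection of finitely many open half-spaces is open and convex, so
   these are exactly the open convex polygons (d = 2) and polyhedra (d = 3). *)
Definition convex_polyhedral_domain Omega :=
  [/\ Omega !=set0, bounded_set Omega &
    exists m (A : 'M[R]_(m, d)) (b : 'cV[R]_m),
      Omega = [set x : 'rV[R]_d | forall k, (A *m x^T) k ord0 < b k ord0]].

End domain.

Section sobolev.
Context {R : realType} {d : nat}.
Variable Omega : set 'rV[R]_d.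

(* Scalar and vector fields are functions on all of R^d; only their values on
   Omega, up to null sets, matter below. *)
Definition sfield := 'rV[R]_d -> R.
Definition vfield := 'I_d -> sfield.

Implicit Types (v w g : sfield) (a b : vfield).

Definition integ v : R := \int[lebesgue_rV d]_(x in Omega) v x.

Definition L2 v :=
  measurable_fun Omega v /\
  (lebesgue_rV d).-integrable Omega (fun x => (v x ^+ 2)%:E).

Definition ip v w : R := integ (fun x => v x * w x).
Definition vdot a b : sfield := fun x => \sum_i a i x * b i x.
Definition vip a b : R := integ (vdot a b).
Definition L2norm v : R := Num.sqrt (ip v v).
Definition vL2norm a : R := Num.sqrt (vip a a).

Definition partial (i : 'I_d) v : sfield :=
  fun x => 'D_(delta_mx ord0 i) (v : 'rV[R]_d -> R^o) x.

Definition smooth v := forall s : seq 'I_d,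
  let w := foldr partial v s in
  continuous (w : 'rV[R]_d -> R^o) /\
  forall i x, derivable (w : 'rV[R]_d -> R^o) x (delta_mx ord0 i).

Definition test_function v := smooth v /\
  exists K : set 'rV[R]_d,
    [/\ compact K, K `<=` Omega & forall x, ~ K x -> v x = 0].

Definition is_weak_partial (i : 'I_d) v g := L2 g /\
  forall phi, test_function phi -> ip v (partial i phi) = - ip g phi.

(* The weak derivative is determined up to a null set of Omega; one
   representative is chosen. *)
Definition weak_partial (i : 'I_d) v : sfield :=
  xget (0 : sfield) [set g | is_weak_partial i v g].

Definition grad v : vfield := fun i => weak_partial i v.
Definition divergence a : sfield := fun x => \sum_i weak_partial i (a i) x.

Definition H1 v := L2 v /\ forall i, exists g, is_weak_partial i v g.

(* Closure of the test functions for the H^1 norm. *)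
Definition H10 v := H1 v /\ forall eps : R, 0 < eps ->
  exists2 phi, test_function phi &
    L2norm (v - phi) ^+ 2 +
      vL2norm (fun i => weak_partial i v - partial i phi) ^+ 2 < eps.

Definition H10v a := forall i, H10 (a i).

Definition L20 v := L2 v /\ integ v = 0.

(* a . grad v *)
Definition advect a v : sfield := vdot a (grad v).
Definition vadvect a b : vfield := fun i => advect a (b i).

Definition vgrad_ip a b : R :=
  integ (fun x => \sum_i vdot (grad (a i)) (grad (b i)) x).

End sobolev.

Arguments sfield : clear implicits.
Arguments vfield : clear implicits.

Section scheme.
Context {R : realType} {d : nat}.

(* F is a primitive of f, and f coincides with the derivative phi^3 - phi of
   the double-well potential on [-K, K]; K = +oo is the polynomial itself,
   whose derivative 3 phi^2 - 1 is unbounded on the real line, and finite K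
   covers its truncations outside of [-K, K]. *)
Definition double_well (K : \bar R) (F f : R -> R) :=
  (forall s : R, is_derive s 1 F (f s)) /\
  forall s : R, (`|s|%:E <= K)%E -> f s = s ^+ 3 - s.

Definition derivative_bound (f : R -> R) (L : R) :=
  forall s : R, derivable f s 1 /\ `|derive1 f s| <= L.

Record state := State {
  phase : sfield R d; chem : sfield R d; vel : vfield R d; pres : sfield R d }.

Variable Omega : set 'rV[R]_d.

Definition state_space (z : state) :=
  [/\ H1 Omega (phase z), H1 Omega (chem z), H10v Omega (vel z) &
      L20 Omega (pres z)].

Definition divergence_free (a : vfield R d) :=
  forall q, L20 Omega q -> ip Omega (divergence Omega a) q = 0.

(* The starting velocities satisfy the incompressibility constraint that the
   scheme imposes on the later ones. *)
Definition starting_value (z : state) :=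
  state_space z /\ divergence_free (vel z).

(* The semi-implicit Euler step: y and z are the states at levels n - 1 and n,
   zt is the unfiltered state at level n + 1. *)
Definition euler_step (f : R -> R) (S dt : R) (y z zt : state) :=
  let phib := phase z *+ 2 - phase y in
  let velb := vel z *+ 2 - vel y in
  [/\ state_space zt,
      forall psi, H1 Omega psi ->
        dt^-1 * ip Omega (phase zt - phase z) psi
        + ip Omega (advect Omega (vel zt) phib) psi
        + vip Omega (grad Omega (chem zt)) (grad Omega psi) = 0,
      forall omega, H1 Omega omega ->
        - ip Omega (chem zt) omega
        + vip Omega (grad Omega (phase zt)) (grad Omega omega)
        + S * dt * ip Omega (phase zt - phase z) omega
        + ip Omega (fun x => 2 * f (phase z x) - f (phase y x)) omega = 0,
      forall v, H10v Omega v ->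
        dt^-1 * vip Omega (vel zt - vel z) v
        + vgrad_ip Omega (vel zt) v
        + vip Omega (vadvect Omega velb (vel zt)) v
        - ip Omega (pres zt) (divergence Omega v)
        - vip Omega (fun i x => chem zt x * grad Omega phib i x) v = 0 &
      forall q, L20 Omega q -> ip Omega (divergence Omega (vel zt)) q = 0].

(* s is some measurable representative of the filtered variable; measurability
   is not implied by the equality because lebesgue_rV lives on the Borel sets. *)
Definition filtered (sy sz st s : sfield R d) :=
  measurable_fun Omega s /\
  s = (fun x => st x - 3^-1 * (st x - 2 * sz x + sy x))
    %[ae lebesgue_rV d in Omega].

Inductive pressure_option := OptionA | OptionB.

Definition filter_step (opt : pressure_option) (y z zt z' : state) :=
  [/\ filtered (phase y) (phase z) (phase zt) (phase z'),
      filtered (chem y) (chem z) (chem zt) (chem z'),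
      forall i, filtered (vel y i) (vel z i) (vel zt i) (vel z' i) &
      match opt with
      | OptionA => filtered (pres y) (pres z) (pres zt) (pres z')
      | OptionB => measurable_fun Omega (pres z') /\
          pres z' = pres zt %[ae lebesgue_rV d in Omega]
      end].

(* z n is the state at level n, and zt n the unfiltered one, for 2 <= n <= N. *)
Definition time_filtered_scheme (f : R -> R) (S dt : R) (N : nat)
    (opt : pressure_option) (z zt : nat -> state) :=
  forall n, (1 <= n <= N - 1)%N ->
    euler_step f S dt (z n.-1) (z n) (zt n.+1) /\
    filter_step opt (z n.-1) (z n) (zt n.+1) (z n.+1).

(* E^(n+1) when y and z are the states at levels n and n + 1. *)
Definition energy (F : R -> R) (L : R) (y z : state) : R :=
  4^-1 * (vL2norm Omega (grad Omega (phase z)) ^+ 2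
    + vL2norm Omega (grad Omega (phase z *+ 2 - phase y)) ^+ 2
    + vL2norm Omega (grad Omega (phase z - phase y)) ^+ 2)
  + 4^-1 * (vL2norm Omega (vel z) ^+ 2
    + vL2norm Omega (vel z *+ 2 - vel y) ^+ 2
    + vL2norm Omega (vel z - vel y) ^+ 2)
  + 3 * L * L2norm Omega (phase z - phase y) ^+ 2
  + ip Omega (F \o phase z) (cst 1)
  + 2^-1 * ip Omega (fun x => F (phase z x) - F (phase y x)) (cst 1).

End scheme.

Arguments state : clear implicits.

(* Main.v *)
Require Import Defs.
From HB Require Import structures.
From mathcomp Require Import all_boot all_order all_algebra.
From mathcomp Require Import all_classical all_reals all_analysis.
From mathcomp Require Import measurable_realfun ring lra.

Set Implicit Arguments.
Unset Strict Implicit.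
Unset Printing Implicit Defensive.

Import Order.TTheory GRing.Theory Num.Theory.
Import numFieldNormedType.Exports.

Local Open Scope classical_set_scope.
Local Open Scope ring_scope.

(** The estimate is obtained by testing the four equations of a step with
    mu~, phi~ - phi^n, u~ and p~. The two coupling terms between phase and
    velocity cancel, the pressure term vanishes with the divergence, the terms
    |grad mu~|^2 and |grad u~|^2 have a sign, and what remains is
      (grad phi~, grad (phi~ - phi^n)) + S dt |phi~ - phi^n|^2
        + (2 f(phi^n) - f(phi^(n-1)), phi~ - phi^n) + (u~ - u^n, u~) <= 0,
    provided that the convection term ((ub . grad) u~, u~) vanishes. Undoing the
    filter expresses phi~ and u~ by the filtered levels n + 1, n, n - 1; then
    the first and last products dominate the decrease of the quadratic parts of
    the energy ([bdf2_G_stability], an exact identity up to a square), and the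
    two middle terms dominate the decrease of the potential part
    ([potential_decay], a pointwise inequality that only uses F' = f and the
    Lipschitz constant L of f).

    The convection term is the delicate point. In dimension three its
    integrability rests on Sobolev embeddings; these are avoided as follows.
    An integral that is not finite has the value 0 here, so only the integrable
    case matters. There, u~ is damped: with r = 1 / (1 + e |u~|^2), the product
    r^2 ((ub . grad) u~) . u~ is -1 / (2 e) times ub . grad r, and both r and
    the field r^2 u~ are bounded Lipschitz functions of the values of u~.
    Integration by parts against test functions therefore passes to the limit
    in u~ and in ub, which lie in the closure of the test functions, and turns
    the integral into that of r div ub, which is 0 ([damped_convection_eq0]).
    Dominated convergence as e tends to 0 removes the damping
    ([convection_eq0]).

    Weak gradients are chosen representatives, so their linearity almost
    everywhere is a uniqueness statement: a square-integrable function that is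
    orthogonal to the test functions vanishes ([L2_test_eq0]). It is proved with
    explicit test functions, products of the flat functions
    s^-n exp(-1/s) composed with affine maps, which converge to the indicators
    of the polyhedra contained in the domain; these polyhedra generate the Borel
    sets of the domain. The classical integration by parts reduces to
    [integral_partial_eq0]. *)

(** * Integrals and square-integrable fields *)

Section integration.
Context {R : realType} {d : nat} (Omega : set 'rV[R]_d).
Hypothesis mOmega : measurable Omega.
Hypothesis finOmega : (lebesgue_rV d Omega < +oo)%E.
Implicit Types v w g : sfield R d.

Definition intg v := (lebesgue_rV d).-integrable Omega (EFin \o v).

Lemma intg_meas v : intg v -> measurable_fun Omega v.
Proof. by move=> /integrableP[/measurable_EFinP]. Qed.

Lemma intgD v w : intg v -> intg w -> intg (fun x => v x + w x).
Proof. by move=> iv iw; have := integrableD mOmega iv iw; apply: eq_integrable. Qed.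

Lemma intgZ r v : intg v -> intg (fun x => r * v x).
Proof. by move=> iv; have := integrableZl mOmega r iv; apply: eq_integrable. Qed.

Lemma intgB v w : intg v -> intg w -> intg (fun x => v x - w x).
Proof. by move=> iv iw; have := integrableB mOmega iv iw; apply: eq_integrable. Qed.

Lemma intg_sum (I : Type) (s : seq I) (h : I -> sfield R d) :
  (forall i, intg (h i)) -> intg (fun x => \sum_(i <- s) h i x).
Proof.
move=> hi; elim: s => [|i s ih].
  by have := integrable0 (lebesgue_rV d) Omega; apply: eq_integrable => // x _; rewrite /= big_nil.
have := intgD (hi i) ih; apply: eq_integrable => // x _ /=.
by rewrite big_cons.
Qed.

Lemma le_intg v w : measurable_fun Omega v ->
  (forall x, Omega x -> `|v x| <= w x) -> intg w -> intg v.
Proof.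
move=> mv vw; apply: le_integrable => //; first exact/measurable_EFinP.
by move=> x Ox /=; rewrite lee_fin (le_trans (vw x Ox))// ler_norm.
Qed.

Lemma intg_abs v : intg v -> intg (fun x => `|v x|).
Proof. by move=> iv; have := integrable_norm iv; apply: eq_integrable. Qed.

Lemma intg_bounded v (M : R) : measurable_fun Omega v ->
  (forall x, Omega x -> `|v x| <= M) -> intg v.
Proof.
move=> mv vM; apply: measurable_bounded_integrable => //.
exists M; split; first exact: num_real.
move=> y My x Ox; apply: (le_trans (vM x Ox)); exact: ltW.
Qed.

Lemma integD v w : intg v -> intg w ->
  integ Omega (fun x => v x + w x) = integ Omega v + integ Omega w.
Proof. exact: RintegralD. Qed.

Lemma integB v w : intg v -> intg w ->
  integ Omega (fun x => v x - w x) = integ Omega v - integ Omega w.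
Proof. exact: RintegralB. Qed.

Lemma integZ r v : intg v -> integ Omega (fun x => r * v x) = r * integ Omega v.
Proof. exact: RintegralZl. Qed.

Lemma eq_integ v w : (forall x, Omega x -> v x = w x) -> integ Omega v = integ Omega w.
Proof. by move=> vw; apply: eq_Rintegral => x; rewrite inE => /vw. Qed.

Lemma integ0 : integ Omega (fun=> 0) = 0.
Proof. by rewrite /integ Rintegral_cst// mul0r. Qed.

Lemma integ_sum (I : Type) (s : seq I) (h : I -> sfield R d) :
  (forall i, intg (h i)) ->
  integ Omega (fun x => \sum_(i <- s) h i x) = \sum_(i <- s) integ Omega (h i).
Proof.
move=> hi; elim: s => [|i s ih].
  by rewrite big_nil -[RHS]integ0; apply: eq_integ => x _; rewrite big_nil.
rewrite big_cons -ih -integD//; last exact: intg_sum.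
by apply: eq_integ => x _; rewrite big_cons.
Qed.

Lemma le_integ v w : intg v -> intg w -> (forall x, Omega x -> v x <= w x) ->
  integ Omega v <= integ Omega w.
Proof. by move=> iv iw vw; exact: le_Rintegral. Qed.

Lemma integ_ge0 v : (forall x, Omega x -> 0 <= v x) -> 0 <= integ Omega v.
Proof. by move=> v0; apply: Rintegral_ge0. Qed.

Lemma le_abs_integ v w : intg v -> intg w -> (forall x, Omega x -> `|v x| <= w x) ->
  `|integ Omega v| <= integ Omega w.
Proof.
move=> iv iw vw; apply: (le_trans (le_normr_Rintegral mOmega iv)).
by apply: le_integ => //; exact: intg_abs.
Qed.

Lemma integ_ae v w : measurable_fun Omega v -> measurable_fun Omega w ->
  v = w %[ae lebesgue_rV d in Omega] -> integ Omega v = integ Omega w.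
Proof.
move=> mv mw vw; congr fine; apply: ae_eq_integral => //.
- exact/measurable_EFinP.
- exact/measurable_EFinP.
- by apply: filterS vw => x /= vw Ox; rewrite vw.
Qed.

Lemma intg_ae v w : measurable_fun Omega w ->
  v = w %[ae lebesgue_rV d in Omega] -> intg v -> intg w.
Proof.
move=> mw vw iv; have mv := intg_meas iv; move: iv => /integrableP[_ iv].
apply/integrableP; split; first exact/measurable_EFinP.
rewrite (le_lt_trans _ iv)// le_eqVlt; apply/orP; left; apply/eqP.
apply: ae_eq_integral => //.
- by apply: measurableT_comp => //; apply/measurable_EFinP.
- by apply: measurableT_comp => //; apply/measurable_EFinP.
- by apply: filterS vw => x /= vw Ox; rewrite vw.
Qed.

(** The extended-real integral is then infinite, and [fine] sends it to 0. *)
Lemma integ_not_intg v : measurable_fun Omega v -> ~ intg v -> integ Omega v = 0.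
Proof.
move=> mv niv; rewrite /integ /Rintegral.
have [fv|] := boolP (\int[lebesgue_rV d]_(x in Omega) (v x)%:E \is a fin_num)%E.
  exfalso; apply: niv; apply/integrableP; split; first exact/measurable_EFinP.
  apply/abse_integralP => //; first exact/measurable_EFinP.
  by move: fv; rewrite fin_num_abs.
by rewrite fin_numEn => /orP[/eqP->|/eqP->].
Qed.

Lemma aeq_refl v : v = v %[ae lebesgue_rV d in Omega].
Proof. exact: aeW. Qed.

Lemma L2M v w : L2 Omega v -> L2 Omega w -> intg (fun x => v x * w x).
Proof.
move=> [mv iv] [mw iw].
apply: (@le_intg _ (fun x => v x ^+ 2 + w x ^+ 2)); last exact: intgD.
  exact: measurable_funM.
move=> x _; rewrite normrM.
rewrite -(real_normK (num_real (v x))) -(real_normK (num_real (w x))).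
move: (normr_ge0 (v x)) (normr_ge0 (w x)) => *; nra.
Qed.

Lemma L2Mb v w (M : R) : L2 Omega v -> measurable_fun Omega w ->
  (forall x, Omega x -> `|w x| <= M) -> L2 Omega (fun x => w x * v x).
Proof.
move=> [mv iv] mw wM; split; first exact: measurable_funM.
apply: (@le_intg _ (fun x => M ^+ 2 * v x ^+ 2)); last exact: intgZ.
  by apply: measurable_funX; exact: measurable_funM.
move=> x Ox; rewrite exprMn normrM ger0_norm ?sqr_ge0// ger0_norm ?sqr_ge0//.
rewrite ler_wpM2r ?sqr_ge0// -(real_normK (num_real (w x))) ler_sqr ?nnegrE//.
  exact: wM.
exact: le_trans (wM x Ox).
Qed.

Lemma L2_bounded v (M : R) : measurable_fun Omega v ->
  (forall x, Omega x -> `|v x| <= M) -> L2 Omega v.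
Proof.
move=> mv vM; split => //; apply: (@intg_bounded _ (M ^+ 2)).
  exact: measurable_funX.
move=> x Ox; rewrite normrX ler_sqr ?nnegrE//; first exact: vM.
exact: le_trans (vM x Ox).
Qed.

Lemma L2_cst r : L2 Omega (cst r).
Proof. by apply: (@L2_bounded _ `|r|) => //. Qed.

Lemma L2_intg v : L2 Omega v -> intg v.
Proof.
move=> L2v; have := L2M L2v (L2_cst 1); apply: eq_integrable => // x _ /=.
by rewrite mulr1.
Qed.

Lemma L2D v w : L2 Omega v -> L2 Omega w -> L2 Omega (fun x => v x + w x).
Proof.
move=> [mv iv] [mw iw]; split; first exact: measurable_funD.
apply: (@le_intg _ (fun x => 2 * (v x ^+ 2 + w x ^+ 2))).
- by apply: measurable_funX; exact: measurable_funD.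
- move=> x _; rewrite ger0_norm ?sqr_ge0// -subr_ge0.
  have -> : 2 * (v x ^+ 2 + w x ^+ 2) - (v x + w x) ^+ 2 = (v x - w x) ^+ 2 by ring.
  exact: sqr_ge0.
- by apply: intgZ; exact: intgD.
Qed.

Lemma L2Z r v : L2 Omega v -> L2 Omega (fun x => r * v x).
Proof. by move=> L2v; apply: (@L2Mb _ (cst r) `|r|). Qed.

Lemma L2B v w : L2 Omega v -> L2 Omega w -> L2 Omega (fun x => v x - w x).
Proof.
move=> Lv Lw; have := L2D Lv (L2Z (-1) Lw).
by under eq_fun do rewrite mulN1r.
Qed.

Lemma L2_abs v : L2 Omega v -> L2 Omega (fun x => `|v x|).
Proof.
move=> [mv iv]; split; first exact: measurableT_comp.
by move: iv; apply: eq_integrable => // x _; rewrite real_normK ?num_real.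
Qed.

Lemma L2_sum (I : Type) (s : seq I) (h : I -> sfield R d) :
  (forall i, L2 Omega (h i)) -> L2 Omega (fun x => \sum_(i <- s) h i x).
Proof.
move=> hi; elim: s => [|i s ih].
  by under eq_fun do rewrite big_nil; exact: L2_cst.
by under eq_fun do rewrite big_cons; exact: L2D.
Qed.

Lemma L2_ae v w : measurable_fun Omega w ->
  v = w %[ae lebesgue_rV d in Omega] -> L2 Omega v -> L2 Omega w.
Proof.
move=> mw vw [mv iv]; split => //; apply: (@intg_ae (fun x => v x ^+ 2)) => //.
- exact: measurable_funX.
- by apply: filterS vw => x /= vw Ox; rewrite vw.
Qed.

Lemma ipC v w : ip Omega v w = ip Omega w v.
Proof. by apply: eq_integ => x _; rewrite mulrC. Qed.

Lemma ipDl v w g : L2 Omega v -> L2 Omega w -> L2 Omega g ->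
  ip Omega (fun x => v x + w x) g = ip Omega v g + ip Omega w g.
Proof.
move=> Lv Lw Lg; rewrite -integD; [|exact: L2M..].
by apply: eq_integ => x _; rewrite mulrDl.
Qed.

Lemma ipBl v w g : L2 Omega v -> L2 Omega w -> L2 Omega g ->
  ip Omega (fun x => v x - w x) g = ip Omega v g - ip Omega w g.
Proof.
move=> Lv Lw Lg; rewrite -integB; [|exact: L2M..].
by apply: eq_integ => x _; rewrite mulrBl.
Qed.

Lemma ipZl r v g : L2 Omega v -> L2 Omega g ->
  ip Omega (fun x => r * v x) g = r * ip Omega v g.
Proof.
move=> Lv Lg; rewrite -integZ; last exact: L2M.
by apply: eq_integ => x _; rewrite mulrA.
Qed.

Lemma ip_ge0 v : 0 <= ip Omega v v.
Proof. by apply: integ_ge0 => x _; rewrite -expr2 sqr_ge0. Qed.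

Lemma L2norm_ge0 v : 0 <= L2norm Omega v. Proof. exact: sqrtr_ge0. Qed.

Lemma L2normE v : L2norm Omega v ^+ 2 = ip Omega v v.
Proof. by rewrite sqr_sqrtr// ip_ge0. Qed.

Lemma ip_ae v v' w w' : L2 Omega v -> L2 Omega v' -> L2 Omega w -> L2 Omega w' ->
  v = v' %[ae lebesgue_rV d in Omega] -> w = w' %[ae lebesgue_rV d in Omega] ->
  ip Omega v w = ip Omega v' w'.
Proof.
move=> [? _] [? _] [? _] [? _] vv' ww'; apply: integ_ae.
- exact: measurable_funM.
- exact: measurable_funM.
- by apply: filterS2 vv' ww' => x /= vv' ww' Ox; rewrite vv'// ww'.
Qed.

Lemma cauchy_schwarz v w : L2 Omega v -> L2 Omega w ->
  `|ip Omega v w| <= L2norm Omega v * L2norm Omega w.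
Proof.
move=> Lv Lw.
have key (t : R) : 0 <= ip Omega v v - 2 * t * ip Omega v w + t ^+ 2 * ip Omega w w.
  have -> : ip Omega v v - 2 * t * ip Omega v w + t ^+ 2 * ip Omega w w =
    ip Omega (fun x => v x - t * w x) (fun x => v x - t * w x).
    rewrite ipBl ?ipZl; [|by repeat first [exact: Lv|exact: Lw|exact: L2Z|apply: L2B]..].
    rewrite [ip _ v (fun x => _ - _)]ipC [ip _ w (fun x => _ - _)]ipC.
    rewrite !ipBl ?ipZl; [|by repeat first [exact: Lv|exact: Lw|exact: L2Z|apply: L2B]..].
    by rewrite (ipC w v); ring.
  exact: ip_ge0.
rewrite -ler_sqr ?nnegrE ?mulr_ge0 ?L2norm_ge0// exprMn !L2normE.
rewrite real_normK ?num_real//.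
(* The quadratic in t becomes affine when w has norm 0; it is then negative at
   the value of t below unless the product vanishes. *)
have := ip_ge0 w; rewrite le_eqVlt => /predU1P[w0|w0].
  have [->|vw0] := eqVneq (ip Omega v w) 0; first by rewrite expr0n/= mulr_ge0 ?ip_ge0.
  have := key ((ip Omega v v + 1) / (2 * ip Omega v w)).
  have -> : 2 * ((ip Omega v v + 1) / (2 * ip Omega v w)) * ip Omega v w
    = ip Omega v v + 1 by field.
  by rewrite -w0 mulr0 addr0; lra.
have := key (ip Omega v w / ip Omega w w).
rewrite -(@pmulr_rge0 _ (ip Omega w w))//.
set a := ip Omega v v; set b := ip Omega v w; set c := ip Omega w w.
have -> : c * (a - 2 * (b / c) * b + (b / c) ^+ 2 * c) = a * c - b ^+ 2.
  by field; rewrite gt_eqF.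
by rewrite subr_ge0.
Qed.

Lemma le_integM_norm v w : L2 Omega v -> L2 Omega w ->
  integ Omega (fun x => `|v x| * `|w x|) <= L2norm Omega v * L2norm Omega w.
Proof.
move=> Lv Lw; have := cauchy_schwarz (L2_abs Lv) (L2_abs Lw).
have abs2 u : L2norm Omega (fun x => `|u x|) = L2norm Omega u.
  by congr Num.sqrt; apply: eq_integ => x _; rewrite -!expr2 real_normK ?num_real.
by rewrite !abs2; apply: le_trans; rewrite ler_norm.
Qed.

End integration.

(** * Topology and measurability in R^n *)

Section topology_rV.
Context {R : realType}.

Lemma rV_ballP n (x y : 'rV[R]_n) (e : R) : 0 < e ->
  ball x e y <-> forall i, `|x ord0 i - y ord0 i| < e.
Proof.
move=> e0; split => [[_ h] i|h]; first exact: h.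
by split => // j i; rewrite ord1; exact: h.
Qed.

Lemma norm_rV_le n (x : 'rV[R]_n) i : `|x ord0 i| <= `|x|.
Proof.
rewrite [leRHS]/Num.norm /= mx_normrE; apply/bigmax_geP; right => /=.
by exists (ord0, i).
Qed.

Lemma continuous_rV (T : topologicalType) n (f : T -> 'rV[R]_n) :
  (forall i, continuous (fun t => f t ord0 i)) -> continuous f.
Proof.
move=> cf t; apply/cvg_ballP => e e0.
suff : \forall u \near t, forall i, `|f t ord0 i - f u ord0 i| < e.
  by apply: filterS => u h; apply/rV_ballP.
apply: filter_forall => i; have /cvgrPdist_lt := cf i t; exact.
Qed.

(** The boxes with rational centres and radii 1 / (k + 1) are a countable base of
    the norm topology. *)
Lemma open_measurable_rV n (A : set 'rV[R]_n) : open A -> measurable A.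
Proof.
move=> oA.
pose box (p : 'rV[rat]_n * nat) := \bigcap_(i : 'I_n)
  ((fun x : 'rV[R]_n => x ord0 i : measurableTypeR R) @^-1`
     (ball (ratr (p.1 ord0 i) : R) (p.2.+1%:R^-1))).
pose B (p : 'rV[rat]_n * nat) := if pselect (box p `<=` A) then box p else set0.
have -> : A = \bigcup_p B p.
  apply/seteqP; split => [x Ax|x [p _]]; last first.
    by rewrite /B; case: pselect => // h /h.
  have /nbhs_ballP[e /= e0 eA] : nbhs x A by exact: open_nbhs_nbhs.
  have [k ke] : exists k : nat, k.+1%:R^-1 < e / 2.
    have /= h := near_infty_natSinv_lt (PosNum (divr_gt0 e0 (ltr0n R 2))).
    by case: h => k _ /(_ k (leqnn k)); exists k.
  have k0 : 0 < k.+1%:R^-1 :> R by rewrite invr_gt0.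
  have q_ i : exists q : rat, `|x ord0 i - ratr q| < k.+1%:R^-1.
    move: (k.+1%:R^-1) k0 => r r0.
    have : x ord0 i - r < x ord0 i + r by lra.
    move=> /rat_in_itvoo[q]; rewrite in_itv /= => /andP[q1 q2]; exists q.
    by rewrite ltr_norml; apply/andP; split; lra.
  have [q qP] := choice q_.
  exists (\row_i q i, k) => //; rewrite /B; case: pselect => [h i _ /=|[]].
    by rewrite mxE /ball/= distrC.
  move=> y yb; apply: eA; apply/rV_ballP => // i.
  have := yb i I; rewrite /= mxE /ball/= => h1.
  rewrite -(subrK (ratr (q i)) (x ord0 i)) -addrA.
  by rewrite (le_lt_trans (ler_normD _ _))// (splitr e) ltrD// (lt_trans _ ke).
apply: countable_bigcupT_measurable; first exact: countableP.
move=> p; rewrite /B; case: pselect => //= h; apply: fin_bigcap_measurable => // i _.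
rewrite -[X in measurable X]setTI; apply: measurable_coord => //.
exact: measurable_ball.
Qed.

Lemma continuous_measurable_rV n (f : 'rV[R]_n -> R) :
  continuous (f : 'rV[R]_n -> R^o) -> measurable_fun setT f.
Proof.
move=> /continuousP cf; apply: (measurability _ (RGenOpens.measurableE R)).
move=> _ [_ [a [b ->] <-]]; rewrite setTI; apply: open_measurable_rV.
exact/cf/interval_open.
Qed.

Lemma contD (T : topologicalType) (f g : T -> R^o) :
  continuous f -> continuous g -> continuous (fun x => f x + g x : R^o).
Proof. by move=> cf cg x; apply: (continuousD (cf x) (cg x)). Qed.

Lemma contM (T : topologicalType) (f g : T -> R^o) :
  continuous f -> continuous g -> continuous (fun x => f x * g x : R^o).
Proof. by move=> cf cg x; apply: (continuousM (cf x) (cg x)). Qed.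

Lemma cont_cst (T : topologicalType) (r : R) : continuous (fun _ : T => r : R^o).
Proof. by move=> x; exact: cst_continuous. Qed.

Lemma cont_sum (T : topologicalType) (I : Type) (s : seq I) (f : I -> T -> R^o) :
  (forall i, continuous (f i)) -> continuous (fun x => \sum_(i <- s) f i x : R^o).
Proof.
move=> cf; elim: s => [|i s ih].
  rewrite (_ : (fun _ => _) = fun=> 0); first exact: cont_cst.
  by apply/funext => x; rewrite big_nil.
rewrite (_ : (fun _ => _) = fun x => f i x + \sum_(i <- s) f i x); first exact: contD.
by apply/funext => x; rewrite big_cons.
Qed.

Lemma cont_coord d (i : 'I_d) : continuous (fun x : 'rV[R]_d => x ord0 i : R^o).
Proof. exact: coord_continuous. Qed.

Lemma continuous_linear_form d (c : 'I_d -> R) :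
  continuous (fun x : 'rV[R]_d => \sum_i c i * x ord0 i : R^o).
Proof.
apply: cont_sum => i; apply: contM; first exact: cont_cst.
exact: cont_coord.
Qed.

Lemma polyhedronE d m (A : 'M[R]_(m, d)) (x : 'rV[R]_d) k :
  (A *m x^T) k ord0 = \sum_i A k i * x ord0 i.
Proof. by rewrite mxE; apply: eq_bigr => i _; rewrite mxE. Qed.

Lemma polyhedron_open d m (A : 'M[R]_(m, d)) (b : 'cV[R]_m) :
  open [set x : 'rV[R]_d | forall k, (A *m x^T) k ord0 < b k ord0].
Proof.
rewrite openE => x Px; rewrite /interior.
suff : \forall y \near x, forall k, (A *m y^T) k ord0 < b k ord0 by [].
apply: (@filter_forall _ _ _ _ (nbhs_filter x)) => k.
have /= := Px k; rewrite polyhedronE => xk.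
have := @continuous_linear_form d (A k) x _ (open_nbhs_nbhs (conj (@open_lt R (b k ord0)) xk)).
by apply: (@filterS _ _ (nbhs_filter x)) => y /=; rewrite polyhedronE.
Qed.

Lemma bounded_finite d (Omega : set 'rV[R]_d) : measurable Omega ->
  bounded_set Omega -> (lebesgue_rV d Omega < +oo)%E.
Proof.
move=> mO [M [_ MO]].
(* One unit more than the bound on the norm, as the boxes are open. *)
pose a : 'rV[R]_d := \row_i (- (`|M| + 2)); pose b : 'rV[R]_d := \row_i (`|M| + 2).
have ab i : a ord0 i <= b ord0 i by rewrite !mxE; have := normr_ge0 M; lra.
apply: (@le_lt_trans _ _ (lebesgue_rV d [set x : 'rV[R]_d | forall i, x ord0 i \in `]a ord0 i, b ord0 i[])).
  apply: le_measure; rewrite ?inE//; last first.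
    move=> x Ox i; have : `|x ord0 i| <= `|M| + 1.
      apply: (le_trans (norm_rV_le x i)); apply: MO => //.
      by rewrite ltr_pwDr// ler_norm.
    by rewrite !mxE in_itv/= ler_norml => /andP[? ?]; apply/andP; split; lra.
  rewrite (_ : mkset _ = \bigcap_(i : 'I_d)
     ((fun x : 'rV[R]_d => x ord0 i : measurableTypeR R) @^-1`
        `]a ord0 i, b ord0 i[%classic)); last first.
    by apply/seteqP; split => x /= h i => [_|]; exact: h.
  apply: fin_bigcap_measurable => // i _.
  by rewrite -[X in measurable X]setTI; apply: measurable_coord.
by rewrite lebesgue_rV_box// ltry.
Qed.

End topology_rV.

(** * The integral of a partial derivative *)

Section slices.
Context {R : realType}.

(** Directional derivatives only see the function along a line. *)
Lemma derive_along_line (U V : normedModType R) (f : U -> R^o) (g : V -> R^o)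
    (x u : U) (y v : V) : (forall h : R, f (h *: u + x) = g (h *: v + y)) ->
  (derivable f x u -> derivable g y v) /\ 'D_u f x = 'D_v g y.
Proof.
move=> fg; have fgx : f x = g y by have := fg 0; rewrite !scale0r !add0r.
have e : (fun h => h^-1 *: ((f \o shift x) (h *: u) - f x)) =
         (fun h => h^-1 *: ((g \o shift y) (h *: v) - g y)).
  by apply/funext => h; rewrite /= fg fgx.
by rewrite /derivable /derive e.
Qed.

Lemma cons_rV_line0 n (t h : R) (y : 'rV[R]_n) :
  h *: delta_mx ord0 ord0 + cons_rV (t, y) = cons_rV (h *: (1 : R^o) + t, y).
Proof.
apply/rowP => j; rewrite mxE; case: (unliftP ord0 j) => [k ->|->].
  by rewrite !cons_rVS !mxE /= mulr0 add0r.
by rewrite !cons_rV0 !mxE eqxx.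
Qed.

Lemma cons_rV_lineS n (t h : R) (y : 'rV[R]_n) i :
  h *: delta_mx ord0 (lift ord0 i) + cons_rV (t, y) =
  cons_rV (t, h *: delta_mx ord0 i + y).
Proof.
apply/rowP => j; rewrite mxE; case: (unliftP ord0 j) => [k ->|->].
  by rewrite !cons_rVS !mxE /= (inj_eq (@lift_inj _ _)).
by rewrite !cons_rV0 !mxE /= mulr0 add0r.
Qed.

Lemma continuous_cons_rV1 n (y : 'rV[R]_n) : continuous (fun t : R => cons_rV (t, y)).
Proof.
apply: continuous_rV => j; case: (unliftP ord0 j) => [k ->|->] t.
  by under eq_fun do rewrite cons_rVS; exact: cst_continuous.
by under eq_fun do rewrite cons_rV0; exact: cvg_id.
Qed.

Lemma continuous_cons_rV2 n (t : R) : continuous (fun y : 'rV[R]_n => cons_rV (t, y)).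
Proof.
apply: continuous_rV => j; case: (unliftP ord0 j) => [k ->|->] y.
  by under eq_fun do rewrite cons_rVS; exact: coord_continuous.
by under eq_fun do rewrite cons_rV0; exact: cst_continuous.
Qed.

Definition centered_box n (M : R) : set 'rV[R]_n := [set x | forall i, `|x ord0 i| <= M].

Lemma measurable_centered_box n M : measurable (@centered_box n M).
Proof.
rewrite (_ : centered_box _ = \bigcap_(i : 'I_n)
     ((fun x : 'rV[R]_n => x ord0 i : measurableTypeR R) @^-1`
        [set t : R | `|t| <= M])); last first.
  by apply/seteqP; split => x /= h i => [_|]; exact: h.
apply: fin_bigcap_measurable => // i _.
rewrite -[X in measurable X]setTI; apply: measurable_coord => //.
rewrite (_ : mkset _ = `[(- M), M]%classic); first exact: measurable_itv.
by apply/seteqP; split => t /=; rewrite in_itv/= ler_norml.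
Qed.

Lemma centered_box_finite n M : (lebesgue_rV n (@centered_box n M) < +oo)%E.
Proof.
apply: bounded_finite; first exact: measurable_centered_box.
exists `|M|; split; first exact: num_real.
move=> y My x xM; rewrite /Num.norm/= mx_normrE; apply/bigmax_leP; split.
  by rewrite (le_trans _ (ltW My)).
move=> [i j] _ /=; rewrite ord1 (le_trans (xM j))// (le_trans (ler_norm _))//.
exact: ltW.
Qed.

Lemma bounded_support_intg n (v : 'rV[R]_n -> R) (M C : R) :
  measurable_fun setT v -> (forall x, `|v x| <= C) ->
  (forall (x : 'rV[R]_n) i, M < `|x ord0 i| -> v x = 0) -> intg setT v.
Proof.
move=> mv vC vM.
have /integrable_mkcond : (lebesgue_rV n).-integrable (centered_box M) (EFin \o v).
  apply: (@intg_bounded _ _ _ (measurable_centered_box _) (centered_box_finite _ _) _ C) => //.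
  exact: measurable_funTS.
move=> /(_ (measurable_centered_box _)).
apply: eq_integrable => // x _; rewrite patchE; case: ifPn => //.
rewrite notin_setE /centered_box/= => /existsNP[i /negP].
by rewrite -ltNge => /vM ->.
Qed.

(** Fubini reduces the claim to the fundamental theorem of calculus on lines; the
    bounds [M] and [C] make the derivative integrable and pass to slices. *)
Lemma integral_partial_eq0 n (i : 'I_n) (w : 'rV[R]_n -> R) (M C : R) :
  (forall x, derivable (w : _ -> R^o) x (delta_mx ord0 i)) ->
  continuous (partial i w : _ -> R^o) ->
  (forall x, `|partial i w x| <= C) ->
  (forall (x : 'rV[R]_n) j, M < `|x ord0 j| -> w x = 0) ->
  (forall (x : 'rV[R]_n) j, M < `|x ord0 j| -> partial i w x = 0) ->
  (\int[lebesgue_rV n]_x (partial i w x)%:E = 0)%E.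
Proof.
elim: n i w => [[]//|n IH] i w dw cdw bdw w0 dw0.
have mdw := continuous_measurable_rV cdw.
have idw : (lebesgue_rV n.+1).-integrable setT (EFin \o partial i w).
  exact: bounded_support_intg mdw bdw dw0.
pose h : measurableTypeR R * 'rV[R]_n -> \bar R := EFin \o partial i w \o @cons_rV R n.
have ih : (@lebesgue_measure R \x lebesgue_rV n)%E.-integrable setT h.
  move/integrableP : idw => [_ fi]; apply/integrableP; split.
    apply: measurableT_comp; last exact: measurable_cons_rV.
    exact/measurable_EFinP.
  move: fi; rewrite /lebesgue_rV/= /lebesgue_rV_succ.
  by rewrite ge0_integral_pushforward//; do 2 apply: measurableT_comp => //.
transitivity (\int[@lebesgue_measure R \x lebesgue_rV n]_p h p)%E.
  rewrite [LHS](@integral_pushforward _ _ _ _ _ _ (@measurable_cons_rV R n))//.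
  exact/measurable_EFinP.
case: (unliftP ord0 i) => [j ij|i0].
- rewrite -integral12_prod_meas1// /fubini_F.
  under eq_integral => t _.
    rewrite (_ : (\int[_]_y _)%E = 0%E); first over.
    rewrite /h /=.
    pose wt y := w (cons_rV (t, y)).
    have line y := @derive_along_line _ _ w wt (cons_rV (t, y)) (delta_mx ord0 i) y (delta_mx ord0 j).
    have {}line y : (derivable (wt : _ -> R^o) y (delta_mx ord0 j)) /\
        partial i w (cons_rV (t, y)) = partial j wt y.
      have [h0|l1 l2] := line y; first by rewrite ij cons_rV_lineS.
      by split => //; exact: l1.
    under eq_integral do rewrite (line _).2.
    have e : partial j wt = partial i w \o (fun y => cons_rV (t, y)).
      by apply/funext => y; rewrite -(line y).2.
    apply: IH.
    + by move=> y; exact: (line y).1.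
    + rewrite e => y; apply: continuous_comp; first exact: continuous_cons_rV2.
      exact: cdw.
    + by move=> y; rewrite e /=.
    + by move=> y k yk; apply: (w0 _ (lift ord0 k)); rewrite cons_rVS.
    + by move=> y k yk; rewrite e /=; apply: (dw0 _ (lift ord0 k)); rewrite cons_rVS.
  by rewrite integral0.
- rewrite -integral21_prod_meas1// /fubini_G.
  under eq_integral => y _.
    rewrite (_ : (\int[_]_t _)%E = 0%E); first over.
    rewrite /h /=.
    pose wy (t : R) := w (cons_rV (t, y)).
    have line t : (derivable (wy : R -> R^o) t 1) /\
        partial i w (cons_rV (t, y)) = 'D_1 (wy : R -> R^o) t.
      have [h0|l1 l2] := @derive_along_line _ _ w wy (cons_rV (t, y)) (delta_mx ord0 i) t 1.
        by rewrite i0 cons_rV_line0.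
      by split => //; exact: l1.
    pose b := `|M| + 1.
    have b0 : 0 < b by rewrite ltr_pwDr.
    have Mb : M < `|b| by rewrite gtr0_norm// ltr_pwDr// ler_norm.
    have := @continuous_FTC2 _ (fun t => partial i w (cons_rV (t, y))) wy (- b) b.
    have -> : wy b = 0 by apply: (w0 _ ord0); rewrite cons_rV0.
    have -> : wy (- b) = 0 by apply: (w0 _ ord0); rewrite cons_rV0 normrN.
    rewrite sube0 => FTC; rewrite -[RHS]FTC.
    + rewrite [RHS]integral_mkcond; apply: eq_integral => t _; rewrite patchE.
      case: ifPn => //; rewrite notin_setE/= in_itv/= => /negP.
      rewrite -ler_norml -ltNge => bt; congr EFin; apply: (dw0 _ ord0).
      by rewrite cons_rV0 (lt_trans Mb)// gtr0_norm.
    + by rewrite gtrN.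
    + apply: continuous_subspaceT => t; apply: continuous_comp.
        exact: continuous_cons_rV1.
      exact: cdw.
    + split.
      * by move=> t _; exact: (line t).1.
      * apply: cvg_at_right_filter.
        by apply/differentiable_continuous/derivable1_diffP; exact: (line _).1.
      * apply: cvg_at_left_filter.
        by apply/differentiable_continuous/derivable1_diffP; exact: (line _).1.
    + by move=> t _; rewrite derive1E (line t).2.
  by rewrite integral0.
Qed.

End slices.

(** * C^1 functions and test functions *)

Section C1.
Context {R : realType} {d : nat}.
Implicit Types v w : sfield R d.

Definition C1 v := continuous (v : _ -> R^o) /\ forall i,
  (forall x, derivable (v : _ -> R^o) x (delta_mx ord0 i)) /\
  continuous (partial i v : _ -> R^o).

Lemma partialD i v w x : derivable (v : _ -> R^o) x (delta_mx ord0 i) ->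
  derivable (w : _ -> R^o) x (delta_mx ord0 i) ->
  partial i (fun y => v y + w y) x = partial i v x + partial i w x.
Proof. by move=> dv dw; exact: (deriveD dv dw). Qed.

Lemma partialZ i (r : R) v x : derivable (v : _ -> R^o) x (delta_mx ord0 i) ->
  partial i (fun y => r * v y) x = r * partial i v x.
Proof. by move=> dv; exact: (deriveZ r dv). Qed.

Lemma partialM i v w x : derivable (v : _ -> R^o) x (delta_mx ord0 i) ->
  derivable (w : _ -> R^o) x (delta_mx ord0 i) ->
  partial i (fun y => v y * w y) x = v x * partial i w x + w x * partial i v x.
Proof. by move=> dv dw; exact: (deriveM dv dw). Qed.

Lemma partial_cst i (r : R) x : partial i (fun _ : 'rV[R]_d => r) x = 0.
Proof. exact: derive_cst. Qed.

Lemma C1_cst (r : R) : C1 (fun=> r).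
Proof.
split=> [|i]; first exact: cont_cst.
split=> [x|]; first exact: derivable_cst.
rewrite (_ : partial i _ = fun=> 0); first exact: cont_cst.
by apply/funext => x; rewrite partial_cst.
Qed.

Lemma C1D v w : C1 v -> C1 w -> C1 (fun x => v x + w x).
Proof.
move=> [cv dv] [cw dw]; split=> [|i]; first exact: contD.
split=> [x|]; first by apply: (derivableD ((dv i).1 x) ((dw i).1 x)).
rewrite (_ : partial i _ = fun x => partial i v x + partial i w x).
  exact: (contD (dv i).2 (dw i).2).
by apply/funext => x; rewrite partialD//; [exact: (dv i).1|exact: (dw i).1].
Qed.

Lemma C1M v w : C1 v -> C1 w -> C1 (fun x => v x * w x).
Proof.
move=> [cv dv] [cw dw]; split=> [|i]; first exact: contM.
split=> [x|]; first by apply: (derivableM ((dv i).1 x) ((dw i).1 x)).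
rewrite (_ : partial i _ = fun x => v x * partial i w x + w x * partial i v x).
  by apply: contD; apply: contM => //; [exact: (dw i).2|exact: (dv i).2].
by apply/funext => x; rewrite partialM//; [exact: (dv i).1|exact: (dw i).1].
Qed.

Lemma C1_sum (I : Type) (s : seq I) (f : I -> sfield R d) :
  (forall k, C1 (f k)) -> C1 (fun x => \sum_(k <- s) f k x).
Proof.
move=> cf; elim: s => [|k s ih].
  rewrite (_ : (fun _ => _) = fun=> 0); first exact: C1_cst.
  by apply/funext => x; rewrite big_nil.
rewrite (_ : (fun _ => _) = fun x => f k x + \sum_(k <- s) f k x); first exact: C1D.
by apply/funext => x; rewrite big_cons.
Qed.

Lemma partial_sum i (I : Type) (s : seq I) (f : I -> sfield R d) x :
  (forall k, C1 (f k)) ->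
  partial i (fun x => \sum_(k <- s) f k x) x = \sum_(k <- s) partial i (f k) x.
Proof.
move=> cf; elim: s => [|k s ih].
  rewrite (_ : (fun _ => _) = fun=> 0); first by rewrite partial_cst big_nil.
  by apply/funext => y; rewrite big_nil.
rewrite (_ : (fun _ => _) = fun x => f k x + \sum_(k <- s) f k x).
  rewrite partialD ?big_cons ?ih//; first exact: ((cf k).2 i).1.
  exact: ((C1_sum s cf).2 i).1.
by apply/funext => y; rewrite big_cons.
Qed.

Lemma partialV i v x : v x != 0 -> derivable (v : _ -> R^o) x (delta_mx ord0 i) ->
  partial i (fun y => (v y)^-1) x = - (v x) ^- 2 * partial i v x.
Proof. by move=> v0 dv; exact: (deriveV v0 dv). Qed.

Lemma C1V v : (forall x, v x != 0) -> C1 v -> C1 (fun x => (v x)^-1).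
Proof.
move=> v0 [cv dv].
have cV : continuous (fun x => (v x)^-1 : R^o) by move=> x; exact: (continuousV (v0 x) (cv x)).
split=> [//|i].
split=> [x|]; first by apply: (derivableV (v0 x) ((dv i).1 x)).
rewrite (_ : partial i _ = fun x => - 1 * ((v x)^-1 * (v x)^-1) * partial i v x).
  apply: contM; last exact: (dv i).2.
  by apply: contM; [exact: cont_cst|exact: contM].
apply/funext => x; rewrite partialV//; last exact: (dv i).1.
by rewrite -exprVn expr2 mulN1r.
Qed.

End C1.

Section test_functions.
Context {R : realType} {d : nat} (Omega : set 'rV[R]_d).
Implicit Types v w phi : sfield R d.

Lemma smooth_partial i v : smooth v -> smooth (partial i v).
Proof. by move=> sv s; have := sv (rcons s i); rewrite foldr_rcons. Qed.

Lemma smooth_C1 v : smooth v -> C1 v.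
Proof.
move=> sv; split=> [|i]; first exact: (sv [::]).1.
by split=> [x|]; [exact: (sv [::]).2|exact: (sv [:: i]).1].
Qed.

(** Smoothness speaks of all iterated partial derivatives, so the induction needs
    a class of functions that contains them. *)
Lemma smooth_class (P : sfield R d -> Prop) v :
  (forall v, P v -> C1 v) -> (forall v i, P v -> P (partial i v)) ->
  P v -> smooth v.
Proof.
move=> PC Pp Pv s.
have Ps : P (foldr partial v s) by elim: s => //= i s; exact: Pp.
by split; [exact: (PC _ Ps).1|move=> i; exact: ((PC _ Ps).2 i).1].
Qed.

Lemma smoothD v w : smooth v -> smooth w -> smooth (fun x => v x + w x).
Proof.
move=> sv sw.
apply: (smooth_class (P := fun u => exists a b,
  [/\ smooth a, smooth b & u = fun x => a x + b x])); last by exists v, w.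
  by move=> _ [a [b [/smooth_C1 sa /smooth_C1 sb ->]]]; exact: C1D.
move=> _ i [a [b [sa sb ->]]]; exists (partial i a), (partial i b).
split; [exact: smooth_partial|exact: smooth_partial|].
by apply/funext => x; rewrite partialD//; apply: ((smooth_C1 _).2 i).1.
Qed.

Lemma smoothZ (r : R) v : smooth v -> smooth (fun x => r * v x).
Proof.
move=> sv.
apply: (smooth_class (P := fun u => exists2 a, smooth a & u = fun x => r * a x));
  last by exists v.
  by move=> _ [a /smooth_C1 sa ->]; exact: (C1M (C1_cst r)).
move=> _ i [a sa ->]; exists (partial i a); first exact: smooth_partial.
by apply/funext => x; rewrite partialZ//; apply: ((smooth_C1 sa).2 i).1.
Qed.

Lemma partial_outside i v (K : set 'rV[R]_d) x : closed K ->
  (forall x, ~ K x -> v x = 0) -> ~ K x -> partial i v x = 0.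
Proof.
move=> cK v0 Kx; rewrite /partial (@near_eq_derive _ _ _ _ (cst (0 : R^o))).
  by rewrite derive_cst.
have : nbhs x (~` K) by apply: open_nbhs_nbhs; split => //; exact: closed_openC.
by apply: (@filterS _ _ (nbhs_filter x)) => y; exact: v0.
Qed.

Lemma test_partial i phi : test_function Omega phi -> test_function Omega (partial i phi).
Proof.
move=> [sp [K [cK KO pK]]]; split; first exact: smooth_partial.
exists K; split=> // x Kx; apply: (partial_outside _ _ pK Kx).
by apply: compact_closed => //; exact: norm_hausdorff.
Qed.

Lemma testD v w : test_function Omega v -> test_function Omega w ->
  test_function Omega (fun x => v x + w x).
Proof.
move=> [sv [K [cK KO vK]]] [sw [L [cL LO wL]]]; split; first exact: smoothD.
exists (K `|` L); split; first exact: compactU.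
  by move=> x []; [exact: KO|exact: LO].
by move=> x /not_orP[Kx Lx]; rewrite vK// wL// addr0.
Qed.

Lemma testZ r v : test_function Omega v -> test_function Omega (fun x => r * v x).
Proof.
move=> [sv [K [cK KO vK]]]; split; first exact: smoothZ.
by exists K; split=> // x /vK ->; rewrite mulr0.
Qed.

Lemma compact_support_bounded v (K : set 'rV[R]_d) : continuous (v : _ -> R^o) ->
  compact K -> (forall x, ~ K x -> v x = 0) -> exists C, forall x, `|v x| <= C.
Proof.
move=> cv cK v0; have : compact (v @` K : set R^o).
  by apply: continuous_compact => //; exact: continuous_subspaceT.
move=> /compact_bounded[M [_ vM]]; exists (`|M| + 1) => x.
have [Kx|/v0 ->] := pselect (K x); last by rewrite normr0 addr_ge0.
by apply: vM; [rewrite ltr_pwDr// ler_norm|exists x].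
Qed.

Lemma test_bounded phi : test_function Omega phi -> exists C, forall x, `|phi x| <= C.
Proof.
move=> [/smooth_C1[cp _] [K [cK _ pK]]]; exact: compact_support_bounded cp cK pK.
Qed.

Lemma test_measurable phi : test_function Omega phi -> measurable_fun Omega phi.
Proof.
by move=> [/smooth_C1[cp _] _]; apply: measurable_funTS; exact: continuous_measurable_rV.
Qed.

Hypothesis mOmega : measurable Omega.
Hypothesis finOmega : (lebesgue_rV d Omega < +oo)%E.

Lemma test_L2 phi : test_function Omega phi -> L2 Omega phi.
Proof.
move=> tp; have [C pC] := test_bounded tp.
by apply: (@L2_bounded _ _ _ mOmega finOmega _ C) => //; exact: test_measurable.
Qed.

Lemma integ_partial_eq0 i v (K : set 'rV[R]_d) : C1 v -> compact K -> K `<=` Omega ->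
  (forall x, ~ K x -> v x = 0) -> integ Omega (partial i v) = 0.
Proof.
move=> [cv dv] cK KO v0.
have clK : closed K by apply: compact_closed => //; exact: norm_hausdorff.
have dv0 x : ~ K x -> partial i v x = 0 by exact: partial_outside.
have [C vC] := compact_support_bounded (dv i).2 cK dv0.
have [M [_ KM]] := compact_bounded cK.
have outK (x : 'rV[R]_d) j : `|M| + 1 < `|x ord0 j| -> ~ K x.
  move=> Mx Kx; have : `|x| <= `|M| + 1.
    by apply: KM => //; rewrite ltr_pwDr// ler_norm.
  by move=> /(le_trans (norm_rV_le x j)); rewrite leNgt Mx.
rewrite /integ /Rintegral -[RHS](_ : fine 0%E = 0)//; congr fine.
rewrite integral_mkcond -(@integral_partial_eq0 _ _ i v (`|M| + 1) C) //.
- apply: eq_integral => x _; rewrite patchE; case: ifPn => //.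
  by rewrite notin_setE => Ox; rewrite dv0// => /KO.
- exact: (dv i).1.
- exact: (dv i).2.
- by move=> x j /outK/v0.
- by move=> x j /outK/dv0.
Qed.

Lemma C1_bounded_support_intg v (K : set 'rV[R]_d) : continuous (v : _ -> R^o) -> compact K ->
  (forall x, ~ K x -> v x = 0) -> intg Omega v.
Proof.
move=> cv cK v0; have [C vC] := compact_support_bounded cv cK v0.
apply: (@intg_bounded _ _ _ mOmega finOmega _ C) => //.
by apply: measurable_funTS; exact: continuous_measurable_rV.
Qed.

Lemma test_by_parts i phi v : test_function Omega phi -> C1 v ->
  integ Omega (fun x => phi x * partial i v x) =
  - integ Omega (fun x => partial i phi x * v x).
Proof.
move=> tphi cv; have [C1p C1p'] := (smooth_C1 tphi.1, smooth_C1 (test_partial i tphi).1).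
have [_ [K [cK KO pK]]] := tphi; have [_ [K' [cK' K'O pK']]] := test_partial i tphi.
have i1 : intg Omega (fun x => phi x * partial i v x).
  apply: (@C1_bounded_support_intg _ K) => //.
  - by apply: contM; [exact: C1p.1|exact: (cv.2 i).2].
  - by move=> x /pK ->; rewrite mul0r.
have i2 : intg Omega (fun x => partial i phi x * v x).
  apply: (@C1_bounded_support_intg _ K') => //.
  - by apply: contM; [exact: C1p'.1|exact: cv.1].
  - by move=> x /pK' ->; rewrite mul0r.
apply/eqP; rewrite -addr_eq0 -integD//; apply/eqP.
rewrite -[RHS](@integ_partial_eq0 i (fun x => phi x * v x) K) //.
- apply: eq_integ => x _; rewrite partialM; first by rewrite [v x * _]mulrC.
    exact: (C1p.2 i).1.
  exact: (cv.2 i).1.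
- exact: C1M.
- by move=> x /pK ->; rewrite mul0r.
Qed.

End test_functions.

(** * Smooth approximation of polyhedra *)

Section bump.
Context {R : realType}.

(** The family is closed under differentiation, which makes each member smooth;
    all of them are flat at 0. *)
Definition flat (n : nat) (s : R) : R := if 0 < s then s ^- n * expR (- s^-1) else 0.

Lemma flat_le n (s : R) : `|flat n s| <= n.+2`!%:R * s ^+ 2.
Proof.
rewrite /flat; case: ifPn => [s0|_]; last by rewrite normr0 mulr_ge0 ?sqr_ge0.
rewrite ger0_norm; last by rewrite mulr_ge0 ?expR_ge0// invr_ge0 exprn_ge0// ltW.
have := @expR_ge1Dxn R s^-1 n.+1; rewrite invr_ge0 => /(_ (ltW s0)) h.
have {}h : s^-1 ^+ n.+2 / n.+2`!%:R <= expR s^-1 by apply: le_trans h; rewrite lerDr.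
have f0 : 0 < n.+2`!%:R :> R by rewrite ltr0n fact_gt0.
rewrite expRN ler_pdivrMr ?expR_gt0//.
move: (n.+2`!%:R : R) f0 h => c c0 h.
have -> : s ^- n = c * s ^+ 2 * (s^-1 ^+ n.+2 / c).
  rewrite [_ / c]mulrC mulrACA divff ?gt_eqF// mul1r exprVn !exprS; field.
  by rewrite !gt_eqF ?exprn_gt0.
by rewrite ler_wpM2l// mulr_ge0 ?sqr_ge0 ?ltW.
Qed.

Lemma flat_le0 n (s : R) : s <= 0 -> flat n s = 0.
Proof. by rewrite /flat ltNge => ->. Qed.

Lemma flat_is_derive n (s : R) :
  is_derive s 1 (flat n : R -> R^o) (flat n.+2 s - n%:R * flat n.+1 s).
Proof.
have [s0|s0|s0] := ltgtP s 0.
- apply: (@near_eq_is_derive _ _ _ (cst 0)).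
    have : nbhs s [set t : R | t < 0] by apply: open_nbhs_nbhs; split => //; exact: open_lt.
    by apply: filterS => t /= t0; rewrite /flat ltNge ltW.
  by rewrite /flat !(lt_gtF s0) mulr0 subr0; exact: is_derive_cst.
- apply: (@near_eq_is_derive _ _ _ ((fun t : R => t^-1 : R) ^+ n * (fun t : R => expR (- t^-1) : R))).
    have : nbhs s [set t : R | 0 < t] by apply: open_nbhs_nbhs; split => //; exact: open_gt.
    by apply: filterS => t /= t0; rewrite /flat t0 fctE exprfctE exprVn.
  have sn0 : s != 0 by rewrite gt_eqF.
  have dV : is_derive s 1 (fun t : R => t^-1 : R^o) (- s ^- 2 *: 1).
    by apply: (@is_deriveV _ id) => //.
  have dE : is_derive s 1 (fun t : R => expR (- t^-1)) (expR (- s^-1) * (- (- s ^- 2 *: 1))).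
    by apply: is_derive1_comp.
  have dX := is_deriveX n dV.
  apply: (is_derive_eq (is_deriveM dX dE)).
  rewrite /flat s0 /GRing.scale/= exprfctE ?fctE !exprVn.
  case: n {dX} => [|n] /=; first by rewrite !expr0 !exprS; field.
  by rewrite ?exprVn !exprS; field; rewrite ?expf_neq0 ?sn0.
- have f0 m : flat m s = 0 by apply: flat_le0; rewrite s0.
  have e0 : flat n.+2 s - n%:R * flat n.+1 s = 0 by rewrite !f0 mulr0 subr0.
  rewrite e0 s0.
  have c : (fun h : R => h^-1 *: ((flat n \o shift 0) (h *: (1 : R^o)) - flat n 0)) @ 0^' --> (0 : R^o).
    apply/cvgrPdist_le => e epos; near=> h.
    have h0 : h != 0 by near: h; exact: nbhs_dnbhs_neq.
    rewrite /= addr0 [flat n 0]/flat ltxx subr0 sub0r normrN /GRing.scale/= mulr1 normrM.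
    rewrite normfV ler_pdivrMl ?normr_gt0//.
    apply: (le_trans (flat_le _ _)).
    rewrite -real_normK ?num_real// expr2 mulrA mulrC ler_wpM2l//.
    rewrite -ler_pdivlMl ?ltr0n ?fact_gt0//.
    near: h; apply: dnbhs0_le; rewrite mulr_gt0// invr_gt0 ltr0n fact_gt0//.
  by apply: DeriveDef; [apply/cvg_ex; exists 0|exact: cvg_lim c].
Unshelve. all: by end_near. Qed.

Lemma flat0_ge0 (s : R) : 0 <= flat 0 s <= 1.
Proof.
rewrite /flat; case: ifPn => s0; last by rewrite lexx ler01.
by rewrite expr0 invr1 mul1r expR_ge0/= expR_le1 oppr_le0 invr_ge0 ltW.
Qed.

(** Dilating and shifting by 1 gives smooth approximations of the indicator of
    the positive half-line that vanish near 0. *)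
Lemma flat0_cvg (s : R) :
  (fun m : nat => flat 0 (m%:R * s - 1)) @ \oo --> (if 0 < s then 1 else 0 : R).
Proof.
case: ifPn => [s0|]; last first.
  rewrite -leNgt => s0; apply: cvg_near_cst; apply: nearW => m.
  by apply: flat_le0; rewrite subr_le0 (le_trans _ ler01)// mulr_ge0_le0.
apply/cvgrPdist_le => e e0; near=> m.
have m0 : 0 < m%:R * s - 1.
  rewrite subr_gt0 -ltr_pdivrMr// mul1r; near: m; exact: nbhs_infty_gtr.
have m1 : e^-1 <= m%:R * s - 1.
  rewrite lerBrDr -ler_pdivrMr//; near: m; exact: nbhs_infty_ger.
have /andP[f0 f1] := flat0_ge0 (m%:R * s - 1).
rewrite ger0_norm ?subr_ge0// /flat m0 expr0 invr1 mul1r.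
have := @expR_ge1Dx R (- (m%:R * s - 1)^-1).
have : (m%:R * s - 1)^-1 <= e by rewrite -(invrK e) lef_pV2 ?posrE ?invr_gt0.
lra.
Unshelve. all: by end_near. Qed.

End bump.

Section flat_algebra.
Context {R : realType} {d : nat}.

Definition affine (a : 'I_d -> R) (c : R) : sfield R d :=
  fun x => \sum_i a i * x ord0 i + c.

Lemma affine_line (a : 'I_d -> R) c x i (h : R) :
  affine a c (h *: delta_mx ord0 i + x) = h *: (a i : R^o) + affine a c x.
Proof.
rewrite /affine addrA; congr (_ + _).
rewrite (bigD1 i)//= [in RHS](bigD1 i)//= !mxE !eqxx /= mulr1 mulrDr.
rewrite -!addrA [a i * h]mulrC; congr (_ + (_ + _)); apply: eq_bigr => j ji.
by rewrite !mxE (negbTE ji) mulr0 add0r.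
Qed.

Lemma cont_affine (a : 'I_d -> R) c : continuous (affine a c : _ -> R^o).
Proof. by apply: contD; [exact: continuous_linear_form|exact: cont_cst]. Qed.

Lemma flat_affine_derive n (a : 'I_d -> R) c i x :
  derivable (flat n \o affine a c : _ -> R^o) x (delta_mx ord0 i) /\
  partial i (flat n \o affine a c) x =
  a i * (flat n.+2 (affine a c x) + - n%:R * flat n.+1 (affine a c x)).
Proof.
have [df fE] := flat_is_derive n (affine a c x).
have := @derive_along_line _ _ _ (flat n : R^o -> R^o) (flat n \o affine a c)
  (affine a c x) (a i) x (delta_mx ord0 i).
case=> [h|d1 d2]; first by rewrite /= affine_line.
have dif : differentiable (flat n : R -> R^o) (affine a c x) by apply/derivable1_diffP.
split; first by apply: d1; exact: diff_derivable.
rewrite /partial -d2 deriveE// -[X in 'd _ _ X]mulr1 -[_ * 1]/(a i *: (1 : R^o)).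
by rewrite linearZ -deriveE// fE mulNr.
Qed.

Inductive flat_alg : sfield R d -> Prop :=
| flat_alg_cst r : flat_alg (fun=> r)
| flat_alg_base n a c : flat_alg (flat n \o affine a c)
| flat_alg_add v w : flat_alg v -> flat_alg w -> flat_alg (fun x => v x + w x)
| flat_alg_mul v w : flat_alg v -> flat_alg w -> flat_alg (fun x => v x * w x).

Lemma cont_flat n : continuous (flat n : R -> R^o).
Proof.
move=> s; apply/differentiable_continuous/derivable1_diffP.
by have [] := flat_is_derive n s.
Qed.

Lemma flat_alg_base_C1 n (a : 'I_d -> R) c : C1 (flat n \o affine a c).
Proof.
have cc m : continuous (flat m \o affine a c : _ -> R^o).
  by move=> x; apply: continuous_comp; [exact: cont_affine|exact: cont_flat].
split=> // i; split=> [x|]; first exact: (flat_affine_derive n a c i x).1.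
rewrite (_ : partial i _ = fun x => a i * ((flat n.+2 \o affine a c) x
    + - n%:R * (flat n.+1 \o affine a c) x)).
  apply: contM; first exact: cont_cst.
  by apply: contD => //; apply: contM => //; exact: cont_cst.
by apply/funext => x; rewrite (flat_affine_derive n a c i x).2.
Qed.

Lemma flat_alg_C1 v : flat_alg v -> C1 v.
Proof.
by elim=> *; [exact: C1_cst|exact: flat_alg_base_C1|exact: C1D|exact: C1M].
Qed.

Lemma flat_alg_partial v i : flat_alg v -> flat_alg (partial i v).
Proof.
elim=> [r|n a c|{}v w fv IHv fw IHw|{}v w fv IHv fw IHw].
- rewrite (_ : partial i _ = fun=> 0); first exact: flat_alg_cst.
  by apply/funext => x; rewrite partial_cst.
- rewrite (_ : partial i _ = fun x => a i * ((flat n.+2 \o affine a c) x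
      + - n%:R * (flat n.+1 \o affine a c) x)).
    apply: (flat_alg_mul (flat_alg_cst _)); apply: flat_alg_add.
      exact: flat_alg_base.
    by apply: (flat_alg_mul (flat_alg_cst _)); exact: flat_alg_base.
  by apply/funext => x; rewrite (flat_affine_derive n a c i x).2.
- rewrite (_ : partial i _ = fun x => partial i v x + partial i w x).
    exact: flat_alg_add.
  apply/funext => x; rewrite partialD//.
    exact: ((flat_alg_C1 fv).2 i).1.
  exact: ((flat_alg_C1 fw).2 i).1.
- rewrite (_ : partial i _ = fun x => v x * partial i w x + w x * partial i v x).
    by apply: flat_alg_add; exact: flat_alg_mul.
  apply/funext => x; rewrite partialM//.
    exact: ((flat_alg_C1 fv).2 i).1.
  exact: ((flat_alg_C1 fw).2 i).1.
Qed.

Lemma flat_alg_smooth v : flat_alg v -> smooth v.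
Proof.
apply: smooth_class; first exact: flat_alg_C1.
by move=> {}v i; exact: flat_alg_partial.
Qed.

Lemma flat_alg_prod (I : Type) (s : seq I) (f : I -> sfield R d) :
  (forall k, flat_alg (f k)) -> flat_alg (fun x => \prod_(k <- s) f k x).
Proof.
move=> ff; elim: s => [|k s ih].
  rewrite (_ : (fun _ => _) = fun=> 1); first exact: flat_alg_cst.
  by apply/funext => x; rewrite big_nil.
rewrite (_ : (fun _ => _) = fun x => f k x * \prod_(k <- s) f k x).
  exact: flat_alg_mul.
by apply/funext => x; rewrite big_cons.
Qed.

End flat_algebra.

(** * The fundamental lemma of the calculus of variations *)

Section fundamental_lemma.
Context {R : realType} {d : nat}.

Definition polyhedron m (A : 'M[R]_(m, d)) (b : 'cV[R]_m) : set 'rV[R]_d :=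
  [set x : 'rV[R]_d | forall k, (A *m x^T) k ord0 < b k ord0].

Lemma measurable_polyhedron m (A : 'M[R]_(m, d)) b : measurable (polyhedron A b).
Proof. by apply: open_measurable_rV; exact: polyhedron_open. Qed.

Lemma polyhedronI m (A : 'M[R]_(m, d)) b m' (A' : 'M[R]_(m', d)) b' :
  polyhedron A b `&` polyhedron A' b' = polyhedron (col_mx A A') (col_mx b b').
Proof.
rewrite /polyhedron; apply/seteqP; split => [x [/= h h'] k|x /= h].
  rewrite mul_col_mx; case: (splitP k) => j kj.
    by rewrite (_ : k = lshift m' j) ?col_mxEu//; exact: val_inj.
  by rewrite (_ : k = rshift m j) ?col_mxEd//; exact: val_inj.
by split => k; [have := h (lshift m' k)|have := h (rshift m k)];
  rewrite mul_col_mx ?col_mxEu ?col_mxEd.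
Qed.

Definition approx m (A : 'M[R]_(m, d)) (b : 'cV[R]_m) (j : nat) : sfield R d :=
  fun x => \prod_k flat 0 (j%:R * (b k ord0 - (A *m x^T) k ord0) - 1).

Lemma approx_smooth m (A : 'M[R]_(m, d)) b j : smooth (approx A b j).
Proof.
apply: flat_alg_smooth; apply: flat_alg_prod => k.
rewrite (_ : (fun _ => _) = flat 0 \o affine (fun i => - (j%:R * A k i)) (j%:R * b k ord0 - 1)).
  exact: flat_alg_base.
apply/funext => x; congr (flat _ _); rewrite /affine polyhedronE mulrBr addrAC addrC.
congr (_ + _); rewrite mulr_sumr -sumrN; apply: eq_bigr => i _.
by rewrite mulNr mulrA.
Qed.

Lemma approx_le1 m (A : 'M[R]_(m, d)) b j x : 0 <= approx A b j x <= 1.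
Proof.
rewrite /approx; elim/big_ind : _ => [|u v /andP[u0 u1] /andP[v0 v1]|k _].
- by rewrite ler01 lexx.
- by rewrite mulr_ge0// mulr_ile1.
- exact: flat0_ge0.
Qed.

Lemma approx_cvg m (A : 'M[R]_(m, d)) b x :
  (fun j => approx A b j x) @ \oo --> (\1_(polyhedron A b) x : R).
Proof.
have -> : \1_(polyhedron A b) x = \prod_(k < m) (if 0 < b k ord0 - (A *m x^T) k ord0 then 1 else 0) :> R.
  have [Px|] := pselect (polyhedron A b x).
    by rewrite indicE mem_set// big1// => k _; rewrite subr_gt0 Px.
  move=> nPx; rewrite indicE memNset//; have /existsNP[k kx] := nPx.
  rewrite (bigD1 k)//= subr_gt0; move/negP : kx => /negbTE ->.
  by rewrite mul0r.
apply: (@cvg_big _ _ _ _ _ mul_continuous) => k _.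
exact: flat0_cvg.
Qed.

Variables (Omega : set 'rV[R]_d).
Hypothesis bOmega : bounded_set Omega.

(** The shift by 1 in [approx] keeps the support inside a closed polyhedron at a
    positive distance from the faces. *)
Lemma approx_test m (A : 'M[R]_(m, d)) b j : polyhedron A b `<=` Omega ->
  test_function Omega (approx A b j).
Proof.
move=> PO; split; first exact: approx_smooth.
pose K := \bigcap_(k : 'I_m) [set x : 'rV[R]_d | 1 <= j%:R * (b k ord0 - (A *m x^T) k ord0)].
have KP : K `<=` polyhedron A b.
  move=> x Kx k; have /= := Kx k I; rewrite -subr_gt0.
  case: (ltP 0 (b k ord0 - (A *m x^T) k ord0)) => // k0.
  by move=> /le_trans/(_ (mulr_ge0_le0 (ler0n _ _) k0)); rewrite leNgt ltr01.
have cK : closed K.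
  apply: closed_bigI => k _.
  apply: (@closed_comp _ _
    (fun x : 'rV[R]_d => j%:R * (b k ord0 - (A *m x^T) k ord0) : R^o)
    [set t : R^o | 1 <= t]); last exact: closed_ge.
  move=> x _; rewrite (_ : (fun x => _) = fun x =>
      affine (fun i => - (j%:R * A k i)) (j%:R * b k ord0) x : R^o).
    exact: cont_affine.
  apply/funext => y; rewrite /affine polyhedronE mulrBr addrC; congr (_ + _).
  by rewrite mulr_sumr -sumrN; apply: eq_bigr => i _; rewrite mulNr mulrA.
exists K; split.
- apply: bounded_closed_compact => //.
  case: bOmega => M [Mr MO]; exists M; split => // y My x Kx.
  by apply: (MO y My); exact/PO/KP.
- exact: subset_trans PO.
- move=> x /existsNP[k /not_implyP[_ /= /negP]]; rewrite -ltNge => jx.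
  rewrite /approx (bigD1 k)//= flat_le0 ?mul0r// subr_le0; exact: ltW.
Qed.

Hypothesis mOmega : measurable Omega.
Hypothesis finOmega : (lebesgue_rV d Omega < +oo)%E.

Lemma integral_polyhedron_eq0 (g : sfield R d) m (A : 'M[R]_(m, d)) b :
  L2 Omega g -> (forall phi, test_function Omega phi -> ip Omega g phi = 0) ->
  polyhedron A b `<=` Omega ->
  (\int[lebesgue_rV d]_(x in polyhedron A b) (g x)%:E = 0)%E.
Proof.
move=> Lg g0 PO; have ig := L2_intg mOmega finOmega Lg.
have mP := measurable_polyhedron A b.
have mgP : measurable_fun Omega (fun x => g x * \1_(polyhedron A b) x).
  apply: measurable_funM; [exact: Lg.1|exact: measurable_indic].
have [|||||_ _ cv] := @dominated_convergence _ _ _ (lebesgue_rV d) Omega mOmega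
  (fun j x => (g x * approx A b j x)%:E) (fun x => (g x * \1_(polyhedron A b) x)%:E)
  (fun x => `|g x|%:E).
- move=> j; apply/measurable_EFinP; apply: measurable_funM; first exact: Lg.1.
  by apply: test_measurable; exact: approx_test.
- exact/measurable_EFinP.
- apply: aeW => x Ox; apply: cvg_EFin; first exact: nearW.
  by apply: cvgM; [exact: cvg_cst|exact: approx_cvg].
- exact: intg_abs.
- apply: aeW => x j Ox; rewrite lee_fin normrM ler_piMr//.
  by have /andP[a0 a1] := approx_le1 A b j x; rewrite ger0_norm.
have : (\int[lebesgue_rV d]_(x in Omega) (g x * \1_(polyhedron A b) x)%:E = 0)%E.
  apply: (cvg_unique _ cv); first exact: ereal_hausdorff.
  apply: cvg_near_cst; apply: nearW => j.
  have tj := approx_test j PO; have := g0 _ tj; rewrite /ip /integ /Rintegral.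
  rewrite -[RHS]/(fine 0%E).
  have : intg Omega (fun x => g x * approx A b j x).
    by apply: L2M => //; exact: (test_L2 mOmega finOmega tj).
  by move=> /(integrable_fin_num mOmega) fi h; rewrite -[LHS]fineK; [rewrite h|exact: fi].
move=> <-; rewrite integral_mkcond [RHS]integral_mkcond; apply: eq_integral => x _.
rewrite !patchE indicE; case: ifPn => [Px|Px]; last first.
  by rewrite mulr0; case: ifPn.
by rewrite mem_set ?mulr1//; apply: PO; exact: set_mem.
Qed.

Variables (m0 : nat) (A0 : 'M[R]_(m0, d)) (b0 : 'cV[R]_m0).
Hypothesis OmegaE : Omega = polyhedron A0 b0.

Definition polyhedra : set (set 'rV[R]_d) :=
  [set P | exists m (A : 'M[R]_(m, d)) (b : 'cV[R]_m), P = polyhedron A b].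

(** The preimages of rays under the coordinates are half-spaces. *)
Lemma polyhedra_generate : @measurable _ 'rV[R]_d = <<s polyhedra >>.
Proof.
apply/seteqP; split; last first.
  apply: smallest_sub; first exact: sigma_algebra_measurable.
  by move=> _ [m [A [b ->]]]; exact: measurable_polyhedron.
apply: smallest_sub; first exact: smallest_sigma_algebra.
rewrite -bigcup_seq; apply: bigcup_sub => i _ _ [B mB <-]; rewrite setTI.
have mi : @measurable_fun _ _ (g_sigma_algebraType polyhedra) (measurableTypeR R) setT
    (fun x : 'rV[R]_d => x ord0 i).
  apply: (measurability _ (RGenInftyO.measurableE R)) => _ [_ [c ->] <-].
  rewrite setTI; apply: sub_sigma_algebra.
  exists 1%N, (delta_mx ord0 i), (const_mx c).
  apply/seteqP; split => x /=; rewrite in_itv/=.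
    by move=> xc k; rewrite polyhedronE mxE (bigD1 i)//= big1 ?addr0 => [|j ji];
      rewrite !mxE !ord1 eqxx/= ?eqxx ?mul1r// (negbTE ji) mul0r.
  by move=> /(_ ord0); rewrite polyhedronE mxE (bigD1 i)//= big1 ?addr0 => [|j ji];
    rewrite !mxE !ord1 eqxx/= ?eqxx ?mul1r// (negbTE ji) mul0r.
by have := mi measurableT B mB; rewrite setTI.
Qed.

(** By dominated convergence, [g] has integral 0 over each polyhedron inside the
    domain. The traces of polyhedra on the domain are such sets, and polyhedra
    form a pi-system that generates the measurable sets. *)
Lemma L2_test_eq0 (g : sfield R d) :
  L2 Omega g -> (forall phi, test_function Omega phi -> ip Omega g phi = 0) ->
  g = cst 0 %[ae lebesgue_rV d in Omega].
Proof.
move=> Lg g0; have ig := L2_intg mOmega finOmega Lg.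
have gI S : measurable S -> (\int[lebesgue_rV d]_(x in Omega `&` S) (g x)%:E = 0)%E.
  rewrite polyhedra_generate; move: S.
  have igS S : measurable S -> (lebesgue_rV d).-integrable (Omega `&` S) (EFin \o g).
    by move=> mS; apply: (integrableS mOmega) => //; exact: measurableI.
  have gT : (\int[lebesgue_rV d]_(x in Omega) (g x)%:E = 0)%E.
    by rewrite {1}OmegaE; apply: integral_polyhedron_eq0 => //; rewrite -OmegaE.
  apply: (dynkin_induction polyhedra_generate).
  - move=> _ _ [m [A [b ->]]] [m' [A' [b' ->]]]; rewrite polyhedronI.
    by exists (m + m')%N, (col_mx A A'), (col_mx b b').
  - by rewrite setIT.
  - move=> _ [m [A [b ->]]]; rewrite OmegaE polyhedronI.
    apply: integral_polyhedron_eq0 => //.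
    by rewrite -polyhedronI -OmegaE; exact: subIsetl.
  - move=> S mS S0; move: gT; rewrite -[X in (\int[_]_(x in X) _)%E](setIT Omega) -(setUv S) setIUr.
    rewrite integral_setU ?S0 ?add0e//.
    + exact: measurableI.
    + by apply: measurableI => //; exact: measurableC.
    + rewrite -setIUr setUv setIT; apply/measurable_EFinP; exact: Lg.1.
    + by apply/disj_setPS => x [[_ Sx] [_ /(_ Sx)]].
  - move=> B mB tB B0; rewrite setI_bigcupr integral_bigcup.
    + by apply: eseries0 => k _ _; exact: B0.
    + by apply: trivIset_setIl.
    + by move=> k; exact: measurableI.
    + rewrite -setI_bigcupr; apply: igS; exact: bigcupT_measurable.
have := @integral_ae_eq _ _ _ (lebesgue_rV d) Omega mOmega (cst 0%E) (EFin \o g) ig.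
case=> [|E EO mE|N [mN N0 NO]]; first exact: measurable_cst.
  by rewrite integral0 -(setIidr EO); exact: gI.
exists N; split => // x /= nx; apply: NO => /= h; apply: nx => Ox.
by have [] := h Ox.
Qed.

End fundamental_lemma.

(** * Weak derivatives *)

Section weak_derivatives.
Context {R : realType} {d : nat} (Omega : set 'rV[R]_d).
Hypothesis hO : convex_polyhedral_domain Omega.
Implicit Types (v w g h phi : sfield R d) (a b : vfield R d).

Lemma domain_measurable : measurable Omega.
Proof. by have [_ _ [m [A [b ->]]]] := hO; exact: measurable_polyhedron. Qed.

Lemma domain_finite : (lebesgue_rV d Omega < +oo)%E.
Proof. by have [_ bO _] := hO; apply: bounded_finite => //; exact: domain_measurable. Qed.

Let mO := domain_measurable.
Let fO := domain_finite.

Definition comb (r : R) v (s : R) w : sfield R d := fun x => r * v x + s * w x.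

Lemma L2_comb r v s w : L2 Omega v -> L2 Omega w -> L2 Omega (comb r v s w).
Proof. by move=> Lv Lw; apply: (L2D mO); exact: (L2Z mO). Qed.

Lemma ip_combl r v s w g : L2 Omega v -> L2 Omega w -> L2 Omega g ->
  ip Omega (comb r v s w) g = r * ip Omega v g + s * ip Omega w g.
Proof. by move=> Lv Lw Lg; rewrite ipDl ?ipZl//; exact: (L2Z mO). Qed.

Lemma comb_ae r v v' s w w' :
  v = v' %[ae lebesgue_rV d in Omega] -> w = w' %[ae lebesgue_rV d in Omega] ->
  comb r v s w = comb r v' s w' %[ae lebesgue_rV d in Omega].
Proof. by apply: filterS2 => x vv' ww' Ox; rewrite /comb vv'// ww'. Qed.

Lemma L2norm_comb r v s w : L2 Omega v -> L2 Omega w ->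
  L2norm Omega (comb r v s w) <= `|r| * L2norm Omega v + `|s| * L2norm Omega w.
Proof.
move=> Lv Lw.
rewrite -ler_sqr ?nnegrE ?addr_ge0 ?mulr_ge0 ?L2norm_ge0//.
have Lc := L2_comb r s Lv Lw.
rewrite L2normE ip_combl// [ip _ v _]ipC [ip _ w _]ipC !ip_combl// (ipC _ w v).
rewrite sqrrD !exprMn !L2normE !real_normK ?num_real//.
have := cauchy_schwarz mO Lv Lw; have := ler_norm (r * s * ip Omega v w).
rewrite !normrM; set V := ip _ v v; set W := ip _ w w; set P := ip _ v w.
set x := L2norm _ v; set y := L2norm _ w => h1 h2.
have h3 : `|r| * `|s| * `|P| <= `|r| * `|s| * (x * y) by rewrite ler_wpM2l// mulr_ge0.
have -> : r * (r * V + s * P) + s * (r * P + s * W) = r ^+ 2 * V + (r * s * P) *+ 2 + s ^+ 2 * W.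
  by rewrite mulr2n; ring.
rewrite lerD2r lerD2l lerMn2r/= (le_trans h1)// (le_trans h3)// le_eqVlt; apply/orP; left.
by apply/eqP; ring.
Qed.

Lemma L2norm_leE v (eta : R) : 0 < eta ->
  (L2norm Omega v <= eta) = (ip Omega v v <= eta ^+ 2).
Proof.
move=> eta0; have e0 := ltW eta0.
by rewrite -L2normE ler_sqr ?nnegrE ?L2norm_ge0.
Qed.

Lemma L2norm_ae v w : L2 Omega v -> L2 Omega w ->
  v = w %[ae lebesgue_rV d in Omega] -> L2norm Omega v = L2norm Omega w.
Proof. by move=> Lv Lw vw; rewrite /L2norm (ip_ae mO Lv Lw Lv Lw). Qed.

Lemma L2_test_orth_eq0 g :
  L2 Omega g -> (forall phi, test_function Omega phi -> ip Omega g phi = 0) ->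
  g = cst 0 %[ae lebesgue_rV d in Omega].
Proof.
have [_ bO [m [A [b OE]]]] := hO.
exact: (@L2_test_eq0 _ _ _ bO mO fO _ _ _ OE).
Qed.

Lemma weak_partialP i v : H1 Omega v -> is_weak_partial Omega i v (weak_partial Omega i v).
Proof. by move=> [_ /(_ i)]; exact: xgetPex. Qed.

Lemma weak_partial_L2 i v : L2 Omega (weak_partial Omega i v).
Proof.
rewrite /weak_partial; case: xgetP => [g _ [] //|_].
exact: (L2_cst mO fO 0).
Qed.

(** This is what makes the chosen weak derivatives linear almost everywhere. *)
Lemma weak_partial_unique i v g h : is_weak_partial Omega i v g ->
  is_weak_partial Omega i v h -> g = h %[ae lebesgue_rV d in Omega].
Proof.
move=> [Lg ig] [Lh ih].
have := @L2_test_orth_eq0 (comb 1 g (-1) h) (L2_comb _ _ Lg Lh).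
have h0 phi : test_function Omega phi -> ip Omega (comb 1 g (-1) h) phi = 0.
  move=> tp; rewrite ip_combl//; last exact: (test_L2 mO fO tp).
  by have := ig _ tp; rewrite ih// => /oppr_inj ->; rewrite mul1r mulN1r subrr.
move=> /(_ h0); apply: filterS => x gh Ox.
by have := gh Ox; rewrite /comb mul1r mulN1r => /eqP; rewrite subr_eq0 => /eqP.
Qed.

Lemma is_weak_partial_comb i r v g s w h : L2 Omega v -> L2 Omega w ->
  is_weak_partial Omega i v g -> is_weak_partial Omega i w h ->
  is_weak_partial Omega i (comb r v s w) (comb r g s h).
Proof.
move=> Lv Lw [Lg ig] [Lh ih]; split; first exact: L2_comb.
move=> phi tp; have Lp := test_L2 mO fO tp.
have Ldp := test_L2 mO fO (test_partial i tp).
by rewrite !ip_combl// ig// ih//; ring.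
Qed.

Lemma is_weak_partial_ae i v w g : L2 Omega v -> L2 Omega w ->
  v = w %[ae lebesgue_rV d in Omega] ->
  is_weak_partial Omega i v g -> is_weak_partial Omega i w g.
Proof.
move=> Lv Lw vw [Lg ig]; split => // phi tp; rewrite -ig//.
have Ldp := test_L2 mO fO (test_partial i tp).
by apply/esym; apply: (ip_ae mO) => //; exact: aeq_refl.
Qed.

Lemma H1_comb r v s w : H1 Omega v -> H1 Omega w -> H1 Omega (comb r v s w).
Proof.
move=> Hv Hw; split; first exact: (L2_comb _ _ Hv.1 Hw.1).
move=> i; exists (comb r (weak_partial Omega i v) s (weak_partial Omega i w)).
by apply: is_weak_partial_comb; [exact: Hv.1|exact: Hw.1|exact: weak_partialP..].
Qed.

Lemma weak_partial_comb i r v s w : H1 Omega v -> H1 Omega w ->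
  weak_partial Omega i (comb r v s w) =
  comb r (weak_partial Omega i v) s (weak_partial Omega i w)
    %[ae lebesgue_rV d in Omega].
Proof.
move=> Hv Hw; apply: (@weak_partial_unique i (comb r v s w)).
  by apply: weak_partialP; exact: H1_comb.
by apply: is_weak_partial_comb; [exact: Hv.1|exact: Hw.1|exact: weak_partialP..].
Qed.

Lemma H1_ae v w : measurable_fun Omega w -> v = w %[ae lebesgue_rV d in Omega] ->
  H1 Omega v -> H1 Omega w.
Proof.
move=> mw vw [Lv dv]; have Lw := L2_ae mO mw vw Lv; split => // i.
by have [g wg] := dv i; exists g; exact: is_weak_partial_ae wg.
Qed.

Lemma weak_partial_ae i v w : H1 Omega v -> H1 Omega w ->
  v = w %[ae lebesgue_rV d in Omega] ->
  weak_partial Omega i v = weak_partial Omega i w %[ae lebesgue_rV d in Omega].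
Proof.
move=> Hv Hw vw; apply: (@weak_partial_unique i w); last exact: weak_partialP.
by apply: (is_weak_partial_ae Hv.1 Hw.1 vw); exact: weak_partialP.
Qed.

Lemma vipE a b : (forall i, L2 Omega (a i)) -> (forall i, L2 Omega (b i)) ->
  vip Omega a b = \sum_i ip Omega (a i) (b i).
Proof.
by move=> La Lb; apply: (integ_sum mO) => i; exact: L2M.
Qed.

Lemma vL2normE a : vL2norm Omega a ^+ 2 = vip Omega a a.
Proof.
rewrite sqr_sqrtr//; apply: integ_ge0 => x _; rewrite sumr_ge0// => i _.
by rewrite -expr2 sqr_ge0.
Qed.

(** * Functions vanishing on the boundary *)
Lemma H10_approx v (eta : R) : H10 Omega v -> 0 < eta ->
  exists phi, [/\ test_function Omega phi,
    L2norm Omega (comb 1 v (-1) phi) <= eta &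
    forall j, L2norm Omega (comb 1 (weak_partial Omega j v) (-1) (partial j phi)) <= eta].
Proof.
move=> [Hv ap] eta0; have [phi tp] := ap _ (exprn_gt0 2 eta0).
have -> : v - phi = comb 1 v (-1) phi.
  by apply/funext => x; rewrite /comb mul1r mulN1r.
have -> : (fun i => weak_partial Omega i v - partial i phi) =
    (fun i => comb 1 (weak_partial Omega i v) (-1) (partial i phi)).
  by apply/funext => i; apply/funext => x; rewrite /comb mul1r mulN1r.
have Ld i : L2 Omega (comb 1 (weak_partial Omega i v) (-1) (partial i phi)).
  by apply: L2_comb; [exact: weak_partial_L2|exact: (test_L2 mO fO (test_partial i tp))].
rewrite vL2normE vipE// => h; exists phi; split => //.
  rewrite L2norm_leE// -L2normE (le_trans _ (ltW h))// lerDl.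
  by apply: sumr_ge0 => i _; exact: ip_ge0.
move=> j; rewrite L2norm_leE// (le_trans _ (ltW h))//.
rewrite (bigD1 j)//= addrA addrAC lerDr addr_ge0 ?sqr_ge0//.
by apply: sumr_ge0 => i _; exact: ip_ge0.
Qed.

Lemma approx_H10 v : H1 Omega v ->
  (forall eta : R, 0 < eta -> exists phi, [/\ test_function Omega phi,
    L2norm Omega (comb 1 v (-1) phi) <= eta &
    forall j, L2norm Omega (comb 1 (weak_partial Omega j v) (-1) (partial j phi)) <= eta]) ->
  H10 Omega v.
Proof.
move=> Hv ap; split => // eps eps0.
(* There are d + 1 squared norms, and the bound is strict. *)
pose D : R := d.+2%:R; have D0 : 0 < D by rewrite ltr0n.
pose eta := Num.sqrt (eps / D).
have eta0 : 0 < eta by rewrite sqrtr_gt0 divr_gt0.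
have eta2 : eta ^+ 2 = eps / D by rewrite sqr_sqrtr// ltW// divr_gt0.
have [phi [tp p0 p1]] := ap _ eta0; exists phi => //.
have -> : v - phi = comb 1 v (-1) phi.
  by apply/funext => x; rewrite /comb mul1r mulN1r.
have -> : (fun i => weak_partial Omega i v - partial i phi) =
    (fun i => comb 1 (weak_partial Omega i v) (-1) (partial i phi)).
  by apply/funext => i; apply/funext => x; rewrite /comb mul1r mulN1r.
have Ld i : L2 Omega (comb 1 (weak_partial Omega i v) (-1) (partial i phi)).
  by apply: L2_comb; [exact: weak_partial_L2|exact: (test_L2 mO fO (test_partial i tp))].
rewrite vL2normE vipE//.
apply: (@le_lt_trans _ _ (eta ^+ 2 + \sum_(i < d) eta ^+ 2)).
  apply: lerD; first by rewrite L2normE -L2norm_leE.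
  by apply: ler_sum => i _; rewrite -L2norm_leE.
rewrite sumr_const card_ord -mulrS eta2 -mulr_natr mulrAC ltr_pdivrMr// ltr_pM2l//.
by rewrite /D ltr_nat.
Qed.

Lemma H10_comb r v s w : H10 Omega v -> H10 Omega w -> H10 Omega (comb r v s w).
Proof.
move=> Hv Hw; apply: approx_H10; first exact: (H1_comb _ _ Hv.1 Hw.1).
move=> eta eta0; pose C := `|r| + `|s| + 1.
have C0 : 0 < C by rewrite ltr_wpDl// addr_ge0.
have e0 : 0 < eta / C by rewrite divr_gt0.
have [p [tp p0 p1]] := H10_approx Hv e0; have [q [tq q0 q1]] := H10_approx Hw e0.
have small (a b : sfield R d) : L2 Omega a -> L2 Omega b -> L2norm Omega a <= eta / C ->
    L2norm Omega b <= eta / C -> L2norm Omega (comb r a s b) <= eta.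
  move=> La Lb ea eb; apply: (le_trans (L2norm_comb _ _ La Lb)).
  apply: (@le_trans _ _ (`|r| * (eta / C) + `|s| * (eta / C))).
    by apply: lerD; apply: ler_wpM2l.
  by rewrite -mulrDl mulrA ler_pdivrMr// mulrC ler_wpM2l ?ltW// /C ltrDl.
have Lp := test_L2 mO fO tp; have Lq := test_L2 mO fO tq.
have Ldp j := test_L2 mO fO (test_partial j tp).
have Ldq j := test_L2 mO fO (test_partial j tq).
have C1p := smooth_C1 tp.1; have C1q := smooth_C1 tq.1.
exists (comb r p s q); split.
- by apply: testD; exact: testZ.
- rewrite (_ : comb 1 _ _ _ = comb r (comb 1 v (-1) p) s (comb 1 w (-1) q)).
    exact: (small _ _ (L2_comb 1 (-1) Hv.1.1 Lp) (L2_comb 1 (-1) Hw.1.1 Lq) p0 q0).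
  by apply/funext => x; rewrite /comb; ring.
- move=> j.
  have dE : partial j (comb r p s q) = comb r (partial j p) s (partial j q).
    apply/funext => x; rewrite partialD ?partialZ//.
    + exact: (C1q.2 j).1.
    + exact: (C1p.2 j).1.
    + exact: ((C1M (C1_cst r) C1p).2 j).1.
    + exact: ((C1M (C1_cst s) C1q).2 j).1.
  have Lv := weak_partial_L2 j v; have Lw := weak_partial_L2 j w.
  have Lvw := weak_partial_L2 j (comb r v s w).
  rewrite dE (@L2norm_ae _ (comb r (comb 1 (weak_partial Omega j v) (-1) (partial j p))
    s (comb 1 (weak_partial Omega j w) (-1) (partial j q)))).
  + exact: (small _ _ (L2_comb 1 (-1) Lv (Ldp j)) (L2_comb 1 (-1) Lw (Ldq j)) (p1 j) (q1 j)).
  + exact: (L2_comb 1 (-1) Lvw (L2_comb r s (Ldp j) (Ldq j))).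
  + exact: (L2_comb r s (L2_comb 1 (-1) Lv (Ldp j)) (L2_comb 1 (-1) Lw (Ldq j))).
  + have := weak_partial_comb j r s Hv.1 Hw.1; apply: filterS => x e Ox.
    by have := e Ox; rewrite /comb => ->; ring.
Qed.

Lemma H10_ae v w : measurable_fun Omega w -> v = w %[ae lebesgue_rV d in Omega] ->
  H10 Omega v -> H10 Omega w.
Proof.
move=> mw vw Hv; have Hw := H1_ae mw vw Hv.1; apply: approx_H10; first exact: Hw.
move=> eta eta0; have [p [tp p0 p1]] := H10_approx Hv eta0.
have Lp := test_L2 mO fO tp; have Ldp j := test_L2 mO fO (test_partial j tp).
exists p; split => [//||j].
- rewrite -(L2norm_ae (L2_comb 1 (-1) Hv.1.1 Lp) (L2_comb 1 (-1) Hw.1 Lp)); first exact: p0.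
  by apply: comb_ae; [exact: vw|exact: aeq_refl].
- rewrite -(L2norm_ae (L2_comb 1 (-1) (weak_partial_L2 j v) (Ldp j))
    (L2_comb 1 (-1) (weak_partial_L2 j w) (Ldp j))); first exact: p1.
  apply: comb_ae; last exact: aeq_refl.
  exact: (weak_partial_ae _ Hv.1 Hw vw).
Qed.

Lemma le_eps_eq0 (x C : R) : (forall eta : R, 0 < eta -> `|x| <= C * eta) -> x = 0.
Proof.
move=> h; apply/eqP; rewrite -normr_le0 leNgt; apply/negP => x0.
pose K := `|C| + 1; have K0 : 0 < K by rewrite ltr_wpDl.
have e0 : 0 < `|x| / (2 * K) by rewrite divr_gt0// mulr_gt0.
have := h _ e0; apply/negP; rewrite -ltNge.
have : C * (`|x| / (2 * K)) <= K * (`|x| / (2 * K)).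
  by apply: ler_wpM2r; [exact: ltW|rewrite /K (le_trans (ler_norm C))// lerDl].
have -> : K * (`|x| / (2 * K)) = `|x| / 2 by field; rewrite gt_eqF.
lra.
Qed.

Lemma integ_weak_partial_H10 j v : H10 Omega v -> integ Omega (weak_partial Omega j v) = 0.
Proof.
move=> Hv; apply: (@le_eps_eq0 _ (L2norm Omega (cst 1))) => eta eta0.
have [p [tp _ p1]] := H10_approx Hv eta0.
have Ldp := test_L2 mO fO (test_partial j tp).
have Ld := weak_partial_L2 j v; have L1 := L2_cst mO fO 1.
have p0 : integ Omega (partial j p) = 0.
  have [_ [K [cK KO pK]]] := tp.
  by apply: (@integ_partial_eq0 _ _ Omega _ _ K) => //; exact: smooth_C1 tp.1.
have -> : integ Omega (weak_partial Omega j v) =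
    ip Omega (comb 1 (weak_partial Omega j v) (-1) (partial j p)) (cst 1).
  rewrite ip_combl// mul1r mulN1r.
  have i1 u : ip Omega u (cst 1) = integ Omega u by apply: eq_integ => x _; rewrite mulr1.
  by rewrite !i1 p0 subr0.
apply: (le_trans (cauchy_schwarz mO (L2_comb _ _ Ld Ldp) L1)).
by rewrite mulrC ler_wpM2l ?L2norm_ge0.
Qed.

Lemma divergence_L2 a : L2 Omega (divergence Omega a).
Proof. by apply: (L2_sum mO fO) => i; exact: weak_partial_L2. Qed.

Lemma divergence_mean0 a : H10v Omega a -> L20 Omega (divergence Omega a).
Proof.
move=> Ha; split; first exact: divergence_L2.
rewrite (integ_sum mO); first by rewrite big1// => i _; exact: integ_weak_partial_H10.
by move=> i; apply: (L2_intg mO fO); exact: weak_partial_L2.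
Qed.

(** The divergence has mean 0, so it is itself an admissible pressure test
    function; hence its norm is 0. *)
Lemma divergence_free_orth a g : H10v Omega a -> divergence_free Omega a ->
  L2 Omega g -> ip Omega (divergence Omega a) g = 0.
Proof.
move=> Ha da Lg; have d0 := da _ (divergence_mean0 Ha).
have := cauchy_schwarz mO (divergence_L2 a) Lg.
by rewrite [L2norm _ (divergence _ _)]/L2norm d0 sqrtr0 mul0r normr_le0 => /eqP.
Qed.

Lemma divergence_comb r a s b : H10v Omega a -> H10v Omega b ->
  divergence Omega (fun i => comb r (a i) s (b i)) =
  comb r (divergence Omega a) s (divergence Omega b) %[ae lebesgue_rV d in Omega].
Proof.
move=> Ha Hb.
have : \forall x \ae lebesgue_rV d, forall i, Omega x ->
    weak_partial Omega i (comb r (a i) s (b i)) x =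
    comb r (weak_partial Omega i (a i)) s (weak_partial Omega i (b i)) x.
  by apply: filter_forall => i; exact: (weak_partial_comb _ _ _ (Ha i).1 (Hb i).1).
apply: filterS => x h Ox; rewrite /divergence /comb !mulr_sumr -big_split.
by apply: eq_bigr => i _; rewrite h.
Qed.

Lemma divergence_free_comb r a s b : H10v Omega a -> H10v Omega b ->
  divergence_free Omega a -> divergence_free Omega b ->
  divergence_free Omega (fun i => comb r (a i) s (b i)).
Proof.
move=> Ha Hb da db q [Lq q0].
have La := divergence_L2 a; have Lb := divergence_L2 b.
rewrite (ip_ae mO (divergence_L2 _) (L2_comb r s La Lb) Lq Lq (divergence_comb r s Ha Hb)).
  by rewrite ip_combl// da// db// !mulr0 addr0.
exact: aeq_refl.
Qed.

Lemma divergence_free_ae a b : H10v Omega a -> H10v Omega b ->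
  (forall i, a i = b i %[ae lebesgue_rV d in Omega]) ->
  divergence_free Omega a -> divergence_free Omega b.
Proof.
move=> Ha Hb ab da q Lq; rewrite -(da q Lq); apply: (ip_ae mO) => //.
- exact: divergence_L2.
- exact: divergence_L2.
- exact: Lq.1.
- exact: Lq.1.
- have : \forall x \ae lebesgue_rV d, forall i, Omega x ->
      weak_partial Omega i (a i) x = weak_partial Omega i (b i) x.
    by apply: filter_forall => i; exact: (weak_partial_ae _ (Ha i).1 (Hb i).1 (ab i)).
  by apply: filterS => x h Ox; apply: eq_bigr => i _; rewrite h.
- exact: aeq_refl.
Qed.

End weak_derivatives.

(** * A damping factor *)

Section damping.
Context {R : realType} {d : nat}.
Implicit Types p q : 'I_d -> R.

Definition damp (e : R) p : R := (1 + e * \sum_k p k ^+ 2)^-1.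

Variable e : R.
Hypotheses (e0 : 0 < e) (e1 : e <= 1).

Lemma damp_den_ge p k : 1 + e * p k ^+ 2 <= 1 + e * \sum_k p k ^+ 2.
Proof.
rewrite lerD2l ler_wpM2l ?(ltW e0)// (bigD1 k)//= lerDl.
by apply: sumr_ge0 => i _; exact: sqr_ge0.
Qed.

Lemma damp_den_gt0 p : 0 < 1 + e * \sum_k p k ^+ 2.
Proof.
rewrite ltr_wpDr// mulr_ge0 ?(ltW e0)//.
by apply: sumr_ge0 => i _; exact: sqr_ge0.
Qed.

Lemma damp_gt0 p : 0 < damp e p. Proof. by rewrite invr_gt0 damp_den_gt0. Qed.

Lemma damp_le1 p : damp e p <= 1.
Proof.
rewrite invf_le1 ?damp_den_gt0// lerDl mulr_ge0 ?(ltW e0)//.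
by apply: sumr_ge0 => i _; exact: sqr_ge0.
Qed.

Lemma damp_linear p k : e * `|p k| * damp e p <= 1.
Proof.
rewrite ler_pdivrMr ?damp_den_gt0// mul1r (le_trans _ (damp_den_ge p k))//.
rewrite -(real_normK (num_real (p k))); have := normr_ge0 (p k).
move: (`|p k|) => t t0.
have : 0 <= e * (t ^+ 2 - t + 1).
  rewrite mulr_ge0 ?(ltW e0)//; have := sqr_ge0 (t - 1 / 2).
  by have -> : (t - 1 / 2) ^+ 2 = t ^+ 2 - t + 1 / 4; [field|lra].
by rewrite mulrDr mulrBr; move: e1; lra.
Qed.

Lemma damp_quadratic p i k : e * (`|p i| * `|p k|) * damp e p <= 1.
Proof.
rewrite ler_pdivrMr ?damp_den_gt0// mul1r.
have h : `|p i| * `|p k| <= \sum_k p k ^+ 2.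
  have [->|ik] := eqVneq i k.
    rewrite -expr2 real_normK ?num_real// (bigD1 k)//= lerDl.
    by apply: sumr_ge0 => j _; exact: sqr_ge0.
  rewrite (bigD1 i)//= (bigD1 k)/=; last by rewrite eq_sym.
  rewrite -(real_normK (num_real (p i))) -(real_normK (num_real (p k))) addrA.
  apply: (@le_trans _ _ (`|p i| ^+ 2 + `|p k| ^+ 2)).
    move: (normr_ge0 (p i)) (normr_ge0 (p k)); move: (`|p i|) (`|p k|) => s t *.
    have := sqr_ge0 (s - t); nra.
  by rewrite lerDl; apply: sumr_ge0 => j _; exact: sqr_ge0.
have : e * (`|p i| * `|p k|) <= e * \sum_k p k ^+ 2 by rewrite ler_pM2l.
lra.
Qed.

Definition l1dist p q := \sum_k `|p k - q k|.

Lemma le_l1dist p q k : `|p k - q k| <= l1dist p q.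
Proof. by rewrite /l1dist (bigD1 k)//= lerDl; apply: sumr_ge0. Qed.

(** The denominators differ by sums of (q k - p k) (q k + p k), and the two
    damping factors absorb the growth of q k + p k, even times a weight [c] that
    grows linearly. *)
Lemma damp_diff p q (c M : R) :
  (forall k, `|c| * (e * (`|q k| + `|p k|) * (damp e p * damp e q)) <= M) ->
  `|c * (damp e p - damp e q)| <= M * l1dist p q.
Proof.
move=> cM.
have -> : c * (damp e p - damp e q) =
    \sum_k (q k - p k) * (c * (e * (q k + p k) * (damp e p * damp e q))).
  have -> : \sum_k (q k - p k) * (c * (e * (q k + p k) * (damp e p * damp e q))) =
      c * (damp e p * damp e q) * (e * \sum_k (q k ^+ 2) - e * \sum_k (p k ^+ 2)).
    rewrite -mulrBr -sumrB !mulr_sumr; apply: eq_bigr => k _; ring.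
  have := damp_den_gt0 p; have := damp_den_gt0 q; rewrite /damp.
  move: (\sum_k (p k ^+ 2)) (\sum_k (q k ^+ 2)) => P Q hQ hP.
  by field; rewrite !gt_eqF.
apply: (le_trans (ler_norm_sum _ _ _)); rewrite /l1dist mulr_sumr.
apply: ler_sum => k _; rewrite normrM distrC mulrC ler_wpM2r//.
apply: le_trans (cM k); rewrite normrM ler_wpM2l//.
rewrite !normrM (gtr0_norm e0) (gtr0_norm (damp_gt0 p)) (gtr0_norm (damp_gt0 q)).
rewrite ler_wpM2r ?mulr_ge0 ?(ltW (damp_gt0 _))// ler_wpM2l ?(ltW e0)//.
exact: ler_normD.
Qed.

Lemma damp_lip p q : `|damp e p - damp e q| <= 2 * l1dist p q.
Proof.
have := @damp_diff p q 1 2; rewrite mul1r; apply => k; rewrite normr1 mul1r.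
have := damp_linear p k; have := damp_linear q k.
have := damp_le1 p; have := damp_le1 q; have := damp_gt0 p; have := damp_gt0 q.
have := normr_ge0 (p k); have := normr_ge0 (q k).
move: (damp e p) (damp e q) (`|p k|) (`|q k|) => a b s t s0 t0 a0 b0 a1 b1 h1 h2.
have -> : e * (t + s) * (a * b) = a * (e * t * b) + b * (e * s * a) by ring.
have : a * (e * t * b) <= 1 * 1 by rewrite ler_pM ?mulr_ge0 ?(ltW e0) ?(ltW a0) ?(ltW b0).
have : b * (e * s * a) <= 1 * 1 by rewrite ler_pM ?mulr_ge0 ?(ltW e0) ?(ltW a0) ?(ltW b0).
lra.
Qed.

Lemma damp_bound p i : `|p i| * damp e p <= e^-1.
Proof.
by rewrite -[leRHS]mulr1 ler_pdivlMl// mulrA damp_linear.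
Qed.

(** The partial derivative of [damp e] with respect to p i is -2 e times this. *)
Definition dcoord p i : R := damp e p ^+ 2 * p i.

Lemma dcoord_bound p i : `|dcoord p i| <= e^-1.
Proof.
rewrite /dcoord normrM ger0_norm ?sqr_ge0// expr2 -mulrA [damp e p * `|_|]mulrC.
apply: le_trans (damp_bound p i); rewrite ler_piMl ?damp_le1//.
by rewrite mulr_ge0 ?(ltW (damp_gt0 _)).
Qed.

Lemma dcoord_lip p q i : `|dcoord p i - dcoord q i| <= (2 + 3 * e^-1) * l1dist p q.
Proof.
set D := l1dist p q.
have ei0 : 0 < e^-1 by rewrite invr_gt0.
have D0 : 0 <= D by apply: sumr_ge0.
have h1 : `|q i * (damp e p - damp e q)| <= (1 + e^-1) * D.
  apply: damp_diff => k.
  have := damp_quadratic q i k; have := damp_linear p k; have := damp_bound q i.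
  have := damp_le1 p; have := damp_gt0 p; have := damp_gt0 q.
  have := normr_ge0 (p k); have := normr_ge0 (q k); have := normr_ge0 (q i).
  move: (damp e p) (damp e q) (`|p k|) (`|q k|) (`|q i|) => a b s t z z0 t0 s0 b0 a0 a1 h1 h2 h3.
  have -> : z * (e * (t + s) * (a * b)) = a * (e * (z * t) * b) + (z * b) * (e * s * a) by ring.
  apply: lerD.
    by rewrite -[leRHS]mulr1 ler_pM ?mulr_ge0 ?(ltW e0) ?(ltW a0) ?(ltW b0).
  by rewrite -[leRHS]mulr1 ler_pM ?mulr_ge0 ?(ltW e0) ?(ltW a0) ?(ltW b0).
have -> : dcoord p i - dcoord q i =
    ((p i - q i) * damp e p + q i * (damp e p - damp e q)) * damp e p
    + q i * damp e q * (damp e p - damp e q).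
  by rewrite /dcoord; ring.
have ha : `|(p i - q i) * damp e p| <= D.
  rewrite normrM (gtr0_norm (damp_gt0 p)) (le_trans _ (le_l1dist p q i))//.
  by rewrite ler_piMr ?damp_le1.
have hb : `|q i * damp e q * (damp e p - damp e q)| <= e^-1 * (2 * D).
  rewrite normrM ler_pM//; last exact: damp_lip.
  by rewrite normrM (gtr0_norm (damp_gt0 q)) damp_bound.
have hc : `|((p i - q i) * damp e p + q i * (damp e p - damp e q)) * damp e p| <=
    D + (1 + e^-1) * D.
  rewrite normrM (gtr0_norm (damp_gt0 p)).
  apply: (@le_trans _ _ `|(p i - q i) * damp e p + q i * (damp e p - damp e q)|).
    by rewrite ler_piMr ?damp_le1.
  by apply: (le_trans (ler_normD _ _)); apply: lerD.
apply: (le_trans (ler_normD _ _)); apply: (le_trans (lerD hc hb)).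
by rewrite le_eqVlt; apply/orP; left; apply/eqP; ring.
Qed.

End damping.

(** * Skew-symmetry of the convection term *)

Section trilinear.
Context {R : realType} {d : nat} (Omega : set 'rV[R]_d).
Hypothesis hO : convex_polyhedral_domain Omega.
Implicit Types (v w g h phi : sfield R d) (a b u : vfield R d).

Let mO := domain_measurable hO.
Let fO := domain_finite hO.

Definition damp_field (e : R) u : sfield R d := fun x => damp e (fun k => u k x).
Definition dcoord_field (e : R) u i : sfield R d := fun x => dcoord e (fun k => u k x) i.

Lemma measurable_damp e u : 0 < e -> (forall k, measurable_fun Omega (u k)) ->
  measurable_fun Omega (damp_field e u).
Proof.
move=> e0 mu.
rewrite (_ : damp_field e u = (fun t : R => (1 + e * `|t|)^-1) \o (fun x => \sum_k u k x ^+ 2)).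
  apply: measurableT_comp; last by apply: measurable_sum => k; exact: measurable_funX.
  apply: continuous_measurable_fun => t.
  apply: (@continuousV _ _ (fun t : R => 1 + e * `|t|)).
    by rewrite gt_eqF// ltr_wpDr// mulr_ge0// ltW.
  apply: cvgD; first exact: cvg_cst.
  by apply: cvgM; [exact: cvg_cst|exact: norm_continuous].
apply/funext => x; rewrite /damp_field /damp /= ger0_norm//.
by apply: sumr_ge0 => k _; exact: sqr_ge0.
Qed.

Lemma measurable_dcoord e u i : 0 < e -> (forall k, measurable_fun Omega (u k)) ->
  measurable_fun Omega (dcoord_field e u i).
Proof.
move=> e0 mu; apply: measurable_funM => //.
by apply: measurable_funX; exact: measurable_damp.
Qed.

Section fixed_damping.
Variable e : R.
Hypotheses (e0 : 0 < e) (e1 : e <= 1).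

Lemma damp_field_L2 u : (forall k, L2 Omega (u k)) -> L2 Omega (damp_field e u).
Proof.
move=> Lu; apply: (@L2_bounded _ _ _ mO fO _ 1).
  by apply: measurable_damp => // k; exact: (Lu k).1.
by move=> x _; rewrite ger0_norm ?(ltW (damp_gt0 e0 _))//; exact: damp_le1.
Qed.

(** The derivative of the damping factor along a direction, up to the factor -2e,
    when [D i] is the derivative of [u i]. *)
Definition damp_slope u (D : vfield R d) : sfield R d :=
  fun x => \sum_i dcoord_field e u i x * D i x.

Lemma damp_slope_L2 u D : (forall k, L2 Omega (u k)) -> (forall k, L2 Omega (D k)) ->
  L2 Omega (damp_slope u D).
Proof.
move=> Lu LD; apply: (L2_sum mO fO) => i.
apply: (@L2Mb _ _ _ mO _ _ e^-1) => //.
  by apply: measurable_dcoord => // k; exact: (Lu k).1.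
by move=> x _; exact: dcoord_bound.
Qed.

Lemma damp_test_C1 (phi_ : vfield R d) : (forall k, test_function Omega (phi_ k)) -> C1 (damp_field e phi_).
Proof.
move=> tp; apply: C1V => [x|].
  by rewrite gt_eqF// (damp_den_gt0 e0).
apply: C1D; first exact: C1_cst.
apply: C1M; first exact: C1_cst.
apply: C1_sum => k.
rewrite (_ : (fun x => _) = fun x => phi_ k x * phi_ k x); last first.
  by apply/funext => x; rewrite expr2.
by apply: C1M; exact: smooth_C1 (tp k).1.
Qed.

Lemma partial_damp j (phi_ : vfield R d) x : (forall k, test_function Omega (phi_ k)) ->
  partial j (damp_field e phi_) x =
  - 2 * e * damp_slope phi_ (fun i => partial j (phi_ i)) x.
Proof.
move=> tp; have C1k k : C1 (phi_ k) by exact: smooth_C1 (tp k).1.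
have C1s : C1 (fun x => \sum_k phi_ k x * phi_ k x).
  by apply: C1_sum => k; exact: C1M.
have C1e := C1M (C1_cst e) C1s.
have C1q := C1D (C1_cst 1) C1e.
rewrite (_ : damp_field e phi_ = fun x => (1 + e * \sum_k phi_ k x * phi_ k x)^-1); last first.
  by apply/funext => y; rewrite /damp_field /damp; under eq_bigr do rewrite expr2.
have qE : (1 + e * \sum_k phi_ k x * phi_ k x)^-1 = damp e (fun k => phi_ k x).
  by rewrite /damp; under [in RHS]eq_bigr do rewrite expr2.
have q0 : 1 + e * \sum_k phi_ k x * phi_ k x != 0.
  by rewrite -invr_eq0 qE gt_eqF// damp_gt0.
rewrite (partialV q0 ((C1q.2 j).1 x)) -exprVn qE.
rewrite (partialD (((C1_cst 1).2 j).1 x) ((C1e.2 j).1 x)) partial_cst add0r.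
rewrite (partialZ e ((C1s.2 j).1 x)) (partial_sum j _ x (fun k => C1M (C1k k) (C1k k))).
rewrite /damp_slope !mulr_sumr; apply: eq_bigr => k _.
rewrite (partialM (((C1k k).2 j).1 x) (((C1k k).2 j).1 x)).
by rewrite /dcoord_field /dcoord; ring.
Qed.

Lemma damp_by_parts_test j chi (phi_ : vfield R d) :
  test_function Omega chi -> (forall k, test_function Omega (phi_ k)) ->
  2 * e * ip Omega chi (damp_slope phi_ (fun i => partial j (phi_ i))) =
  ip Omega (partial j chi) (damp_field e phi_).
Proof.
move=> tc tp; have := test_by_parts mO fO j tc (damp_test_C1 tp).
have Lc := test_L2 mO fO tc.
have LS : L2 Omega (damp_slope phi_ (fun i => partial j (phi_ i))).
  apply: damp_slope_L2 => k; first exact: (test_L2 mO fO (tp k)).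
  exact: (test_L2 mO fO (test_partial j (tp k))).
have -> : integ Omega (fun x => chi x * partial j (damp_field e phi_) x) =
    - (2 * e * ip Omega chi (damp_slope phi_ (fun i => partial j (phi_ i)))).
  rewrite -mulNr /ip -(integZ mO); last exact: (L2M mO).
  by apply: eq_integ => x _; rewrite partial_damp//; ring.
by move=> /oppr_inj.
Qed.

(** The components of u are limits of test functions; the damping makes every
    nonlinear term Lipschitz or bounded, so that both sides pass to the limit. *)
Lemma damp_by_parts_chi j chi u : test_function Omega chi -> H10v Omega u ->
  2 * e * ip Omega chi (damp_slope u (fun i => weak_partial Omega j (u i))) =
  ip Omega (partial j chi) (damp_field e u).
Proof.
move=> tc Hu; set D := fun i => weak_partial Omega j (u i).
have Lu k : L2 Omega (u k) by exact: (Hu k).1.1.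
have LD k : L2 Omega (D k) by exact: weak_partial_L2.
have Lc := test_L2 mO fO tc; have Ldc := test_L2 mO fO (test_partial j tc).
have L1 : L2 Omega (cst 1) := L2_cst mO fO 1.
have [Cc cC] := test_bounded tc; have [Cd dC] := test_bounded (test_partial j tc).
have Cc0 : 0 <= Cc by exact: le_trans (cC 0).
have Cd0 : 0 <= Cd by exact: le_trans (dC 0).
(* K collects the bounds on chi and the Lipschitz constants of the damping, B the
   norms that do not depend on the approximation of u. *)
pose K := 2 * e * Cc * (2 + 3 * e^-1) + Cd * 2.
have ei0 : 0 < e^-1 by rewrite invr_gt0.
pose N1 := L2norm Omega (cst 1).
pose B := \sum_(i < d) (N1 + \sum_(k < d) L2norm Omega (D i)) + \sum_(k < d) N1.
apply/eqP; rewrite -subr_eq0; apply/eqP.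
apply: (@le_eps_eq0 _ _ (K * B)) => eta eta0.
have [phi_ phiP] := choice (fun k => H10_approx hO (Hu k) eta0).
have tp k : test_function Omega (phi_ k) by have [] := phiP k.
have Lp k := test_L2 mO fO (tp k).
pose E i := partial j (phi_ i).
have LE i : L2 Omega (E i) := test_L2 mO fO (test_partial j (tp i)).
have := damp_by_parts_test j tc tp; rewrite -/E => /eqP; rewrite -subr_eq0 => /eqP J0.
rewrite -[X in `|X|]subr0 -J0.
have LSu := damp_slope_L2 Lu LD; have LSp := damp_slope_L2 Lp LE.
have Lru := damp_field_L2 Lu; have Lrp := damp_field_L2 Lp.
pose du k := comb 1 (u k) (-1) (phi_ k).
pose dD i := comb 1 (D i) (-1) (E i).
have Ldu k : L2 Omega (du k) by exact: (L2_comb hO).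
have LdD i : L2 Omega (dD i) by exact: (L2_comb hO).
pose M x := \sum_i (`|dD i x| * `|cst 1 x : R| + \sum_k `|du k x| * `|D i x|)
  + \sum_k `|du k x| * `|cst 1 x : R|.
have iabs v w : L2 Omega v -> L2 Omega w -> intg Omega (fun x => `|v x| * `|w x|).
  by move=> Lv Lw; apply: (L2M mO); exact: (L2_abs mO).
have iM1 i : intg Omega (fun x => `|dD i x| * `|cst 1 x : R| + \sum_k `|du k x| * `|D i x|).
  apply: (intgD mO); first exact: iabs.
  by apply: (intg_sum mO) => k; exact: iabs.
have iM2 : intg Omega (fun x => \sum_k `|du k x| * `|cst 1 x : R|).
  by apply: (intg_sum mO) => k; exact: iabs.
have iM : intg Omega M.
  by apply: (intgD mO) => //; exact: (intg_sum mO).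
have MB : integ Omega M <= B * eta.
  rewrite /M (integD mO)//; last exact: (intg_sum mO).
  rewrite (integ_sum mO)// (integ_sum mO); last by move=> k; exact: iabs.
  rewrite /B mulrDl !mulr_suml; apply: lerD; apply: ler_sum => i _.
    rewrite (integD mO); [|exact: iabs|by apply: (intg_sum mO) => k; exact: iabs].
    rewrite (integ_sum mO); last by move=> k; exact: iabs.
    rewrite mulrDl mulr_suml; apply: lerD; last apply: ler_sum => k _.
      apply: (le_trans (le_integM_norm mO (LdD i) L1)); rewrite mulrC.
      by rewrite ler_wpM2l ?L2norm_ge0//; have [_ _] := phiP i; exact.
    apply: (le_trans (le_integM_norm mO (Ldu k) (LD i))); rewrite mulrC.
    by rewrite ler_wpM2l ?L2norm_ge0//; have [_ + _] := phiP k; exact.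
  apply: (le_trans (le_integM_norm mO (Ldu i) L1)); rewrite mulrC.
  by rewrite ler_wpM2l ?L2norm_ge0//; have [_ + _] := phiP i; exact.
pose G x := 2 * e * (chi x * (damp_slope u D x - damp_slope phi_ E x))
  - partial j chi x * (damp_field e u x - damp_field e phi_ x).
have iG1 : intg Omega (fun x => chi x * (damp_slope u D x - damp_slope phi_ E x)).
  by apply: (L2M mO) => //; exact: (L2B mO).
have iG2 : intg Omega (fun x => partial j chi x * (damp_field e u x - damp_field e phi_ x)).
  by apply: (L2M mO) => //; exact: (L2B mO).
have iG : intg Omega G by apply: (intgB mO) => //; exact: (intgZ mO).
rewrite (_ : _ - _ = integ Omega G); last first.
  rewrite /G (integB mO)//; last exact: (intgZ mO).
  rewrite (integZ mO)//.
  have e1' : integ Omega (fun x => chi x * (damp_slope u D x - damp_slope phi_ E x)) =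
      ip Omega chi (damp_slope u D) - ip Omega chi (damp_slope phi_ E).
    by rewrite -(integB mO); [apply: eq_integ => x _; rewrite mulrBr|exact: (L2M mO)..].
  have e2' : integ Omega (fun x => partial j chi x * (damp_field e u x - damp_field e phi_ x)) =
      ip Omega (partial j chi) (damp_field e u) - ip Omega (partial j chi) (damp_field e phi_).
    by rewrite -(integB mO); [apply: eq_integ => x _; rewrite mulrBr|exact: (L2M mO)..].
  by rewrite e1' e2'; ring.
have GM x : `|G x| <= K * M x.
  pose S := \sum_k `|du k x|.
  have S0 : 0 <= S by apply: sumr_ge0.
  have SE : l1dist (fun k => u k x) (fun k => phi_ k x) = S.
    by apply: eq_bigr => k _; rewrite /du /comb mul1r mulN1r.
  have ME : M x = \sum_i (`|dD i x| + S * `|D i x|) + S.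
    rewrite /M normr1 -mulr_suml mulr1; congr (_ + _); apply: eq_bigr => i _.
    by rewrite mulr1 mulr_suml.
  have h1 : `|damp_slope u D x - damp_slope phi_ E x| <=
      (2 + 3 * e^-1) * \sum_i (`|dD i x| + S * `|D i x|).
    rewrite /damp_slope -sumrB mulr_sumr; apply: (le_trans (ler_norm_sum _ _ _)).
    apply: ler_sum => i _.
    have -> : dcoord_field e u i x * D i x - dcoord_field e phi_ i x * E i x =
      (dcoord_field e u i x - dcoord_field e phi_ i x) * D i x +
      dcoord_field e phi_ i x * dD i x by rewrite /dD /comb; ring.
    apply: (le_trans (ler_normD _ _)); rewrite [leRHS]mulrDr [leRHS]addrC; apply: lerD.
      rewrite normrM mulrA ler_wpM2r//.
      by have := dcoord_lip e0 e1 (fun k => u k x) (fun k => phi_ k x) i; rewrite SE.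
    rewrite normrM ler_wpM2r// (le_trans (dcoord_bound e0 e1 _ i))//.
    by move: ei0; lra.
  have h2 : `|damp_field e u x - damp_field e phi_ x| <= 2 * S.
    by have := damp_lip e0 e1 (fun k => u k x) (fun k => phi_ k x); rewrite SE.
  have Q0 : 0 <= \sum_i (`|dD i x| + S * `|D i x|).
    by apply: sumr_ge0 => i _; rewrite addr_ge0// mulr_ge0.
  rewrite ME; move: Q0 h1; set Q := \sum_i _ => Q0 h1.
  rewrite /G; apply: (le_trans (ler_normB _ _)).
  rewrite !normrM (gtr0_norm e0) (gtr0_norm (ltr0n R 2)).
  have a1 : 2 * e * (`|chi x| * `|damp_slope u D x - damp_slope phi_ E x|) <=
      2 * e * (Cc * ((2 + 3 * e^-1) * Q)).
    by rewrite ler_wpM2l ?mulr_ge0 ?(ltW e0)// ler_pM.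
  have a2 : `|partial j chi x| * `|damp_field e u x - damp_field e phi_ x| <= Cd * (2 * S).
    by rewrite ler_pM.
  apply: (le_trans (lerD a1 a2)); rewrite -subr_ge0.
  have b1 : 0 <= 2 * e * Cc * (2 + 3 * e^-1) * S.
    by rewrite !mulr_ge0 ?(ltW e0)// addr_ge0// mulr_ge0 ?(ltW ei0).
  have b2 : 0 <= Cd * 2 * Q by rewrite !mulr_ge0.
  rewrite (_ : _ - _ = 2 * e * Cc * (2 + 3 * e^-1) * S + Cd * 2 * Q) ?addr_ge0//.
  by rewrite /K; move: e^-1 => e'; ring.
apply: (le_trans (le_abs_integ mO iG (intgZ mO K iM) (fun x _ => GM x))).
rewrite (integZ mO)// -mulrA ler_wpM2l//.
rewrite addr_ge0 ?mulr_ge0 ?(ltW e0)// addr_ge0// mulr_ge0 ?(ltW ei0)//.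
Qed.

(** Both sides are continuous in v for the H^1 norm, and v is a limit of test
    functions. *)
Lemma damp_by_parts j v u : H10 Omega v -> H10v Omega u ->
  2 * e * ip Omega v (damp_slope u (fun i => weak_partial Omega j (u i))) =
  ip Omega (weak_partial Omega j v) (damp_field e u).
Proof.
move=> Hv Hu; set W := damp_slope _ _.
have LW : L2 Omega W.
  by apply: damp_slope_L2 => k; [exact: (Hu k).1.1|exact: weak_partial_L2].
have Lr : L2 Omega (damp_field e u) by apply: damp_field_L2 => k; exact: (Hu k).1.1.
have Lv := Hv.1.1; have Ldv := weak_partial_L2 hO j v.
apply/eqP; rewrite -subr_eq0; apply/eqP.
apply: (@le_eps_eq0 _ _ (2 * e * L2norm Omega W + L2norm Omega (damp_field e u))) => eta eta0.
have [chi [tc c0 c1]] := H10_approx hO Hv eta0.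
have Lc := test_L2 mO fO tc; have Ldc := test_L2 mO fO (test_partial j tc).
have := damp_by_parts_chi j tc Hu; rewrite -/W => /eqP; rewrite -subr_eq0 => /eqP J0.
rewrite -[X in `|X|]subr0 -J0.
have -> : 2 * e * ip Omega v W - ip Omega (weak_partial Omega j v) (damp_field e u) -
    (2 * e * ip Omega chi W - ip Omega (partial j chi) (damp_field e u)) =
    2 * e * ip Omega (comb 1 v (-1) chi) W
    - ip Omega (comb 1 (weak_partial Omega j v) (-1) (partial j chi)) (damp_field e u).
  by rewrite !(ip_combl hO)//; ring.
apply: (le_trans (ler_normB _ _)); rewrite [leRHS]mulrDl; apply: lerD.
  rewrite normrM gtr0_norm ?mulr_gt0// -mulrA ler_wpM2l ?mulr_ge0 ?(ltW e0)//.
  apply: (le_trans (cauchy_schwarz mO (L2_comb hO _ _ Lv Lc) LW)).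
  by rewrite mulrC ler_wpM2l ?L2norm_ge0.
apply: (le_trans (cauchy_schwarz mO (L2_comb hO _ _ Ldv Ldc) Lr)).
by rewrite mulrC ler_wpM2l ?L2norm_ge0.
Qed.

Definition convection b u : sfield R d := vdot (vadvect Omega b u) u.

(** Summing [damp_by_parts] over the components of b leaves the divergence of b. *)
Lemma damped_convection_eq0 b u : H10v Omega b -> divergence_free Omega b ->
  H10v Omega u ->
  integ Omega (fun x => damp_field e u x ^+ 2 * convection b u x) = 0.
Proof.
move=> Hb db Hu.
have Lr : L2 Omega (damp_field e u) by apply: damp_field_L2 => k; exact: (Hu k).1.1.
pose W j := damp_slope u (fun i => weak_partial Omega j (u i)).
have LW j : L2 Omega (W j).
  by apply: damp_slope_L2 => k; [exact: (Hu k).1.1|exact: weak_partial_L2].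
have -> : integ Omega (fun x => damp_field e u x ^+ 2 * convection b u x) =
    \sum_j ip Omega (b j) (W j).
  rewrite -(integ_sum mO); last by move=> j; apply: (L2M mO) => //; exact: (Hb j).1.1.
  apply: eq_integ => x _; rewrite /convection /vdot /vadvect /advect /vdot /W /damp_slope.
  under [in RHS]eq_bigr do rewrite mulr_sumr.
  rewrite exchange_big/= mulr_sumr; apply: eq_bigr => i _.
  rewrite mulr_suml mulr_sumr; apply: eq_bigr => k _.
  by rewrite /dcoord_field /dcoord /damp_field /grad; ring.
have : 2 * e * \sum_j ip Omega (b j) (W j) = 0.
  transitivity (ip Omega (divergence Omega b) (damp_field e u)); last exact: (divergence_free_orth hO).
  rewrite mulr_sumr.
  rewrite (eq_bigr (fun j => ip Omega (weak_partial Omega j (b j)) (damp_field e u))); last first.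
    by move=> j _; exact: damp_by_parts.
  rewrite /ip; transitivity (integ Omega (fun x => \sum_j weak_partial Omega j (b j) x * damp_field e u x)).
    rewrite (integ_sum mO)// => j; apply: (L2M mO) => //; exact: weak_partial_L2.
  by apply: eq_integ => x _; rewrite mulr_suml.
by move/eqP; rewrite mulf_eq0 gt_eqF ?mulr_gt0//= => /eqP.
Qed.

End fixed_damping.

Lemma measurable_convection b u : H10v Omega b -> H10v Omega u ->
  measurable_fun Omega (convection b u).
Proof.
move=> Hb Hu; apply: measurable_sum => i; apply: measurable_funM; last exact: (Hu i).1.1.1.
apply: measurable_sum => k; apply: measurable_funM; first exact: (Hb k).1.1.1.
exact: (weak_partial_L2 hO k (u i)).1.
Qed.

Lemma damp_cvg (p : 'I_d -> R) : (fun n : nat => damp n.+1%:R^-1 p) @ \oo --> (1 : R).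
Proof.
rewrite -[X in _ --> X]invr1; apply: cvgV; first exact: oner_neq0.
rewrite -[X in _ --> X]addr0; apply: cvgD; first exact: cvg_cst.
rewrite -[X in _ --> X](mul0r (\sum_k p k ^+ 2)); apply: cvgM; last exact: cvg_cst.
exact: cvg_harmonic.
Qed.

(** The damped integrands are dominated by the undamped one when this is
    integrable, and otherwise its integral is 0 by convention. *)
Lemma convection_eq0 b u : H10v Omega b -> divergence_free Omega b ->
  H10v Omega u -> vip Omega (vadvect Omega b u) u = 0.
Proof.
move=> Hb db Hu; rewrite /vip -/(convection b u).
have mg := measurable_convection Hb Hu.
have mu k : measurable_fun Omega (u k) by exact: (Hu k).1.1.1.
have [ig|nig] := pselect (intg Omega (convection b u)); last exact: integ_not_intg.
have en0 n : 0 < n.+1%:R^-1 :> R by rewrite invr_gt0.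
have en1 n : n.+1%:R^-1 <= 1 :> R by rewrite invf_le1 ?ler1n.
have mr n : measurable_fun Omega (damp_field n.+1%:R^-1 u) by exact: measurable_damp.
pose g_ n x := damp_field n.+1%:R^-1 u x ^+ 2 * convection b u x.
have mg_ n : measurable_fun Omega (g_ n).
  by apply: measurable_funM => //; exact: measurable_funX.
have gg n x : `|g_ n x| <= `|convection b u x|.
  rewrite normrM ler_piMl// ger0_norm ?sqr_ge0// exprn_ile1 ?damp_le1//.
  exact: ltW (damp_gt0 _ _).
have gc x : (fun n => g_ n x) @ \oo --> convection b u x.
  rewrite (_ : (fun n => g_ n x) = fun n => damp n.+1%:R^-1 (fun k => u k x) *
      damp n.+1%:R^-1 (fun k => u k x) * convection b u x); last first.
    by apply/funext => n; rewrite /g_ expr2.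
  suff : (fun n => damp n.+1%:R^-1 (fun k => u k x) * damp n.+1%:R^-1 (fun k => u k x) *
      convection b u x) @ \oo --> 1 * 1 * convection b u x by rewrite !mul1r.
  apply: cvgM; last exact: cvg_cst.
  by apply: cvgM; exact: damp_cvg.
have [|||||_ _ cv] := @dominated_convergence _ _ _ (lebesgue_rV d) Omega mO
  (fun n x => (g_ n x)%:E) (fun x => (convection b u x)%:E)
  (fun x => `|convection b u x|%:E).
- by move=> n; apply/measurable_EFinP; exact: mg_.
- exact/measurable_EFinP.
- by apply: aeW => x Ox; apply: cvg_EFin; [exact: nearW|exact: gc].
- exact: (intg_abs mO ig).
- by apply: aeW => x n Ox; rewrite lee_fin gg.
suff /(congr1 fine) : (\int[lebesgue_rV d]_(x in Omega) (convection b u x)%:E = 0)%E by [].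
apply: (cvg_unique _ cv); first exact: ereal_hausdorff.
apply: cvg_near_cst; apply: nearW => n.
have ign : intg Omega (g_ n).
  by apply: (le_intg mO (mg_ n) _ (intg_abs mO ig)) => x _; exact: gg.
rewrite -[LHS]fineK; last exact: (integrable_fin_num mO ign).
by congr EFin; exact: (damped_convection_eq0 (en0 n) (en1 n) Hb db Hu).
Qed.

End trilinear.

(** * The potential *)

Section potential.
Context {R : realType}.
Implicit Types F f g : R -> R.

Lemma mean_value F f (a b : R) : (forall s : R, is_derive s 1 F (f s)) ->
  exists c, [/\ F a - F b = f c * (a - b) & (b <= c <= a) || (a <= c <= b)].
Proof.
move=> dF.
have cF A : {within A, continuous F}.
  apply: continuous_subspaceT => s.
  by apply/differentiable_continuous/derivable1_diffP; have [] := dF s.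
have [ab|ba|->] := ltgtP a b.
- have [c + e] := MVT ab (fun x _ => dF x) (cF _).
  rewrite in_itv/= => /andP[/ltW ac /ltW cb]; exists c; rewrite ac cb orbT; split => //.
  by rewrite -[LHS]opprB e; ring.
- have [c + e] := MVT ba (fun x _ => dF x) (cF _).
  by rewrite in_itv/= => /andP[/ltW bc /ltW ca]; exists c; rewrite bc ca.
- by exists b; rewrite !subrr mulr0 lexx.
Qed.

Lemma derivative_bound_lip f (L : R) : derivative_bound f L ->
  forall a b, `|f a - f b| <= L * `|a - b|.
Proof.
move=> fL a b; have df (s : R) : is_derive s 1 f (derive1 f s).
  by rewrite derive1E; apply/derivableP; exact: (fL s).1.
have [c [-> _]] := mean_value a b df.
by rewrite normrM ler_wpM2r// (fL c).2.
Qed.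

(** As a function of a, the left-hand side minus the right-hand side is maximal at
    a = b, by the Lipschitz bound on f. *)
Lemma taylor_upper F f (L a b : R) : (forall s : R, is_derive s 1 F (f s)) ->
  (forall s t, `|f s - f t| <= L * `|s - t|) ->
  F a - F b <= f b * (a - b) + L / 2 * (a - b) ^+ 2.
Proof.
move=> dF fL; pose h s := F s - (f b * s + L / 2 * (s - b) ^+ 2).
have dh (s : R) : is_derive s 1 (h : R -> R) (f s - (f b + L * (s - b))).
  have dsb : is_derive s 1 (fun s : R => s - b : R) 1.
    by apply: is_derive_eq; rewrite subr0.
  have dsq := is_deriveX 2 dsb.
  have d1 : is_derive s 1 (f b \*: (@id R)) (f b *: 1) by exact: is_deriveZ.
  have d2 := is_deriveZ (L / 2) dsq.
  apply: (is_derive_eq (is_deriveB (dF s) (is_deriveD d1 d2))).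
  by rewrite /GRing.scale/=; field.
have [c [e cab]] := mean_value a b dh.
suff : h a - h b <= 0.
  by rewrite /h subrr expr0n/= mulr0 addr0; lra.
rewrite e; have := fL c b; case/orP : cab => /andP[h1 h2].
  rewrite [`|c - b|]ger0_norm ?subr_ge0// ler_norml => /andP[_ h3].
  by rewrite mulr_le0_ge0 ?subr_ge0//; lra.
rewrite [`|c - b|]ler0_norm ?subr_le0// ler_norml => /andP[h3 _].
by rewrite mulr_ge0_le0 ?subr_le0//; lra.
Qed.

(** With x = a - b and y = b - c, the increment multiplied by the explicit force is
    (3 x - y) / 2. Replacing F by its quadratic bounds around b leaves L times a
    nonnegative quadratic form in x and y; the factor 3 in the stabilization
    makes it so. *)
Lemma potential_decay F f (L k a b c : R) : (forall s : R, is_derive s 1 F (f s)) ->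
  (forall s t, `|f s - f t| <= L * `|s - t|) -> 0 <= L -> 3 * L <= k ->
  3 * L * (a - b) ^+ 2 + F a + 2^-1 * (F a - F b)
  - (3 * L * (b - c) ^+ 2 + F b + 2^-1 * (F b - F c)) <=
  k * (3 / 2 * a - 2 * b + 1 / 2 * c) ^+ 2
  + (2 * f b - f c) * (3 / 2 * a - 2 * b + 1 / 2 * c).
Proof.
move=> dF fL L0 kL.
have up := taylor_upper a b dF fL; have lo := taylor_upper c b dF fL.
have fbc := fL b c.
set x := a - b in up *; set y := b - c in fbc *.
have cb : c - b = - y by rewrite /y opprB.
rewrite cb in lo.
have AE : 3 / 2 * a - 2 * b + 1 / 2 * c = (3 * x - y) / 2 by rewrite /x /y; field.
rewrite {}AE; clearbody x y; clear cb.
have k1 : 3 * L * ((3 * x - y) / 2) ^+ 2 <= k * ((3 * x - y) / 2) ^+ 2.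
  by rewrite ler_wpM2r ?sqr_ge0.
have f1 : - (L * (`|y| * `|3 * x - y| / 2)) <= (f b - f c) * ((3 * x - y) / 2).
  have : `|(f b - f c) * ((3 * x - y) / 2)| <= L * (`|y| * `|3 * x - y| / 2).
    rewrite !normrM (ger0_norm (ltW _ : 0 <= 2^-1))//.
    by rewrite [leRHS](_ : _ = L * `|y| * (`|3 * x - y| * 2^-1)) ?ler_wpM2r//; ring.
  by rewrite ler_norml => /andP[].
have quad : 0 <= L * (15 / 4 * x ^+ 2 - 9 / 2 * (x * y) + 15 / 4 * y ^+ 2
    - 3 / 4 * x ^+ 2 - 1 / 4 * y ^+ 2 - `|y| * `|3 * x - y| / 2).
  rewrite mulr_ge0// -normrM.
  (* The form equals 3 (x - y)^2 + y^2 or 3 (x - y/2)^2 + 9/4 y^2, according to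
     the sign inside the absolute value. *)
  have s1 := sqr_ge0 (x - y); have s2 := sqr_ge0 y; have s3 := sqr_ge0 (x - y / 2).
  have [h|h] := leP 0 (y * (3 * x - y)).
    rewrite ger0_norm// [leRHS](_ : _ = 3 * (x - y) ^+ 2 + y ^+ 2); last by field.
    by apply: addr_ge0 => //; apply: mulr_ge0.
  rewrite ltr0_norm// [leRHS](_ : _ = 3 * (x - y / 2) ^+ 2 + 9 / 4 * y ^+ 2); last by field.
  by apply: addr_ge0; apply: mulr_ge0.
move: k1 f1 quad up lo; rewrite sqrrN mulrN.
move: (`|y| * `|3 * x - y| / 2) => m.
move: (F a) (F b) (F c) (f b) (f c) => Fa Fb Fc fb_ fc_ k1 f1 quad up lo.
lra.
Qed.

End potential.

(** * Energy decay over one step *)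

Section energy_step.
Context {R : realType} {d : nat} (Omega : set 'rV[R]_d).
Hypothesis hO : convex_polyhedral_domain Omega.
Implicit Types (a b c v w : sfield R d).

Let mO := domain_measurable hO.
Let fO := domain_finite hO.

Definition comb3 (r : R) a (s : R) b (t : R) c : sfield R d :=
  comb 1 (comb r a s b) t c.

Lemma comb3E r a s b t c x : comb3 r a s b t c x = r * a x + s * b x + t * c x.
Proof. by rewrite /comb3 /comb mul1r. Qed.

Lemma L2_comb3 r a s b t c : L2 Omega a -> L2 Omega b -> L2 Omega c ->
  L2 Omega (comb3 r a s b t c).
Proof. by move=> La Lb Lc; apply: (L2_comb hO) => //; exact: (L2_comb hO). Qed.

(** The two sides differ by 3/4 of the squared norm of a - 2 b + c, which is the
    numerical dissipation of the second-order backward difference. *)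
Lemma bdf2_G_stability a b c t s p q p' q' :
  L2 Omega a -> L2 Omega b -> L2 Omega c -> L2 Omega t -> L2 Omega s ->
  L2 Omega p -> L2 Omega q -> L2 Omega p' -> L2 Omega q' ->
  t = comb3 (3 / 2) a (- 1) b (1 / 2) c %[ae lebesgue_rV d in Omega] ->
  s = comb 1 t (-1) b %[ae lebesgue_rV d in Omega] ->
  p = comb 2 a (-1) b %[ae lebesgue_rV d in Omega] ->
  q = comb 1 a (-1) b %[ae lebesgue_rV d in Omega] ->
  p' = comb 2 b (-1) c %[ae lebesgue_rV d in Omega] ->
  q' = comb 1 b (-1) c %[ae lebesgue_rV d in Omega] ->
  4^-1 * (ip Omega a a + ip Omega p p + ip Omega q q)
  - 4^-1 * (ip Omega b b + ip Omega p' p' + ip Omega q' q') <= ip Omega s t.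
Proof.
move=> La Lb Lc Lt Ls Lp Lq Lp' Lq' tE sE pE qE p'E q'E.
have Lt3 : L2 Omega (comb3 (3 / 2) a (- 1) b (1 / 2) c) by exact: L2_comb3.
have Ls3 : L2 Omega (comb3 (3 / 2) a (- 2) b (1 / 2) c) by exact: L2_comb3.
have sE' : s = comb3 (3 / 2) a (- 2) b (1 / 2) c %[ae lebesgue_rV d in Omega].
  apply: filterS2 sE tE => x sE tE Ox; rewrite (sE Ox) /comb (tE Ox) !comb3E.
  by rewrite -[in LHS]mulrA; field.
have LC r v r' w : L2 Omega v -> L2 Omega w -> L2 Omega (comb r v r' w).
  by move=> Lv Lw; exact: (L2_comb hO).
rewrite (ip_ae mO Ls Ls3 Lt Lt3 sE' tE).
rewrite (ip_ae mO Lp (LC 2 _ (-1) _ La Lb) Lp (LC 2 _ (-1) _ La Lb) pE pE).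
rewrite (ip_ae mO Lq (LC 1 _ (-1) _ La Lb) Lq (LC 1 _ (-1) _ La Lb) qE qE).
rewrite (ip_ae mO Lp' (LC 2 _ (-1) _ Lb Lc) Lp' (LC 2 _ (-1) _ Lb Lc) p'E p'E).
rewrite (ip_ae mO Lq' (LC 1 _ (-1) _ Lb Lc) Lq' (LC 1 _ (-1) _ Lb Lc) q'E q'E).
have := ip_ge0 Omega (comb3 1 a (-2) b 1 c).
have exp2 r v r' w r2 r2' : L2 Omega v -> L2 Omega w ->
    ip Omega (comb r v r' w) (comb r2 v r2' w) =
    r * r2 * ip Omega v v + (r * r2' + r' * r2) * ip Omega v w + r' * r2' * ip Omega w w.
  move=> Lv Lw; have Lvw := LC r2 _ r2' _ Lv Lw.
  rewrite (ip_combl hO)// [ip _ v _]ipC [ip _ w _]ipC !(ip_combl hO)// (ipC _ w v).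
  by ring.
have exp3 r1 r2 r3 t1 t2 t3 :
    ip Omega (comb3 r1 a r2 b r3 c) (comb3 t1 a t2 b t3 c) =
    r1 * t1 * ip Omega a a + r2 * t2 * ip Omega b b + r3 * t3 * ip Omega c c
    + (r1 * t2 + r2 * t1) * ip Omega a b + (r1 * t3 + r3 * t1) * ip Omega a c
    + (r2 * t3 + r3 * t2) * ip Omega b c.
  have Lr := LC r1 _ r2 _ La Lb; have Lt' := LC t1 _ t2 _ La Lb.
  have LT := LC 1 _ t3 _ Lt' Lc.
  rewrite /comb3 !(ip_combl hO)// [ip _ a _]ipC [ip _ b _]ipC [ip _ c _]ipC.
  rewrite !(ip_combl hO)// (ipC _ b a) (ipC _ c a) (ipC _ c b).
  by ring.
rewrite !exp3 !exp2//.
move: (ip _ a a) (ip _ b b) (ip _ c c) (ip _ a b) (ip _ a c) (ip _ b c) => *.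
lra.
Qed.

Lemma H1_comb3 r a s b t c : H1 Omega a -> H1 Omega b -> H1 Omega c ->
  H1 Omega (comb3 r a s b t c).
Proof. by move=> Ha Hb Hc; apply: (H1_comb hO) => //; exact: (H1_comb hO). Qed.

Lemma weak_partial_comb3 i r a s b t c : H1 Omega a -> H1 Omega b -> H1 Omega c ->
  weak_partial Omega i (comb3 r a s b t c) =
  comb3 r (weak_partial Omega i a) s (weak_partial Omega i b) t (weak_partial Omega i c)
    %[ae lebesgue_rV d in Omega].
Proof.
move=> Ha Hb Hc; have Hab := H1_comb hO r s Ha Hb.
have e1 := weak_partial_comb hO i 1 t Hab Hc.
have e2 := weak_partial_comb hO i r s Ha Hb.
by apply: filterS2 e1 e2 => x e1 e2 Ox; rewrite /comb3 (e1 Ox) /comb (e2 Ox).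
Qed.

(** What the estimate of a step requires of the two levels that it starts from;
    the filter and the divergence equation hand it on to the new level. *)
Definition admissible (z : state R d) :=
  [/\ H1 Omega (phase z), H10v Omega (vel z) & divergence_free Omega (vel z)].

Lemma filtered_comb3 a b t v : filtered Omega a b t v ->
  comb3 (2 / 3) t (2 / 3) b (- (1 / 3)) a = v %[ae lebesgue_rV d in Omega].
Proof.
move=> [_ vE]; apply: filterS vE => x vE Ox; rewrite (vE Ox) comb3E.
by field.
Qed.

Lemma unfiltered_comb3 a b t v : filtered Omega a b t v ->
  t = comb3 (3 / 2) v (- 1) b (1 / 2) a %[ae lebesgue_rV d in Omega].
Proof.
move=> [_ vE]; apply: filterS vE => x vE Ox; rewrite comb3E (vE Ox).
by field.
Qed.

Lemma H10_filtered a b t v : filtered Omega a b t v ->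
  H10 Omega a -> H10 Omega b -> H10 Omega t -> H10 Omega v.
Proof.
move=> fv Ha Hb Ht; apply: (H10_ae hO fv.1 (filtered_comb3 fv)).
exact: (H10_comb hO _ _ (H10_comb hO _ _ Ht Hb) Ha).
Qed.

Lemma H1_filtered a b t v : filtered Omega a b t v ->
  H1 Omega a -> H1 Omega b -> H1 Omega t -> H1 Omega v.
Proof.
by move=> fv Ha Hb Ht; apply: (H1_ae hO fv.1 (filtered_comb3 fv)); exact: (H1_comb3 _ _ _ Ht Hb Ha).
Qed.

Lemma admissible_step (f : R -> R) (S dt : R) opt (y z zt z' : state R d) :
  admissible y -> admissible z -> euler_step Omega f S dt y z zt ->
  filter_step Omega opt y z zt z' -> admissible z'.
Proof.
move=> [Hy Vy dy] [Hz Vz dz] [[Ht _ Vt _] _ _ _ dt0] [fp _ fv _].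
have V' : H10v Omega (vel z') by move=> i; exact: (H10_filtered (fv i)).
split; [exact: (H1_filtered fp Hy Hz Ht)|exact: V'|].
have Vtz : H10v Omega (fun i => comb (2 / 3) (vel zt i) (2 / 3) (vel z i)).
  by move=> i; exact: (H10_comb hO _ _ (Vt i) (Vz i)).
have V3 : H10v Omega (fun i => comb3 (2 / 3) (vel zt i) (2 / 3) (vel z i) (- (1 / 3)) (vel y i)).
  by move=> i; exact: (H10_comb hO _ _ (Vtz i) (Vy i)).
apply: (divergence_free_ae hO V3 V' (fun i => filtered_comb3 (fv i))).
apply: (divergence_free_comb hO _ _ Vtz Vy _ dy).
exact: (divergence_free_comb hO _ _ Vt Vz dt0 dz).
Qed.

Lemma L2_growth (f : R -> R) (L : R) v : measurable_fun setT f ->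
  (forall s t, `|f s - f t| <= L * `|s - t|) -> L2 Omega v -> L2 Omega (f \o v).
Proof.
move=> mf fL Lv.
have mfv : measurable_fun Omega (f \o v) by apply: measurableT_comp => //; exact: Lv.1.
have Lg : L2 Omega (fun x => `|f 0| + L * `|v x|).
  apply: (L2D mO); first exact: (L2_cst mO fO).
  by apply: (L2Z mO); exact: (L2_abs mO).
split; first exact: mfv.
apply: (le_intg mO _ _ Lg.2); first exact: measurable_funX.
move=> x _; rewrite ger0_norm ?sqr_ge0//=.
have : `|f (v x)| <= `|f 0| + L * `|v x|.
  rewrite -[f (v x)](subrK (f 0)) addrC (le_trans (ler_normD _ _))// lerD2l.
  by have := fL (v x) 0; rewrite subr0.
move=> h; rewrite -(real_normK (num_real (f (v x)))) ler_sqr ?nnegrE//.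
exact: le_trans h.
Qed.

Lemma intg_potential (F f : R -> R) (L : R) v : (forall s : R, is_derive s 1 F (f s)) ->
  (forall s t, `|f s - f t| <= L * `|s - t|) -> L2 Omega v -> intg Omega (F \o v).
Proof.
move=> dF fL Lv.
have mF : measurable_fun setT F.
  apply: continuous_measurable_fun => s.
  by apply/differentiable_continuous/derivable1_diffP; have [] := dF s.
have mFv : measurable_fun Omega (F \o v) by apply: measurableT_comp => //; exact: Lv.1.
have dNF (s : R) : is_derive s 1 (fun s => - F s) (- f s) by exact: is_deriveN.
have NfL s t : `|- f s - - f t| <= L * `|s - t| by rewrite -opprD normrN.
apply: (le_intg mO mFv (w := fun x => `|F 0| + (`|f 0| * `|v x| + L / 2 * v x ^+ 2))).
  move=> x _ /=.
  have up := taylor_upper (v x) 0 dF fL; have lo := taylor_upper (v x) 0 dNF NfL.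
  move: up lo; rewrite subr0 => up lo.
  have fv : `|f 0 * v x| <= `|f 0| * `|v x| by rewrite normrM.
  move: fv (ler_norm (F 0)) (ler_norm (- F 0)); rewrite normrN !ler_norml => /andP[f1 f2] g1 g2.
  by apply/andP; split; lra.
apply: (intgD mO); first by apply: (L2_intg mO fO); exact: (L2_cst mO fO).
apply: (intgD mO); apply: (intgZ mO); last exact: Lv.2.
by apply: (L2_intg mO fO); exact: (L2_abs mO).
Qed.

Lemma potential_step (F f : R -> R) (L k : R) a b c t s :
  (forall r : R, is_derive r 1 F (f r)) -> measurable_fun setT f ->
  (forall r q, `|f r - f q| <= L * `|r - q|) -> 0 <= L -> 3 * L <= k ->
  L2 Omega a -> L2 Omega b -> L2 Omega c -> L2 Omega s ->
  t = comb3 (3 / 2) a (- 1) b (1 / 2) c %[ae lebesgue_rV d in Omega] ->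
  s = comb 1 t (-1) b %[ae lebesgue_rV d in Omega] ->
  3 * L * ip Omega (comb 1 a (-1) b) (comb 1 a (-1) b) + ip Omega (F \o a) (cst 1)
  + 2^-1 * ip Omega (fun x => F (a x) - F (b x)) (cst 1)
  - (3 * L * ip Omega (comb 1 b (-1) c) (comb 1 b (-1) c) + ip Omega (F \o b) (cst 1)
  + 2^-1 * ip Omega (fun x => F (b x) - F (c x)) (cst 1)) <=
  k * ip Omega s s + ip Omega (fun x => 2 * f (b x) - f (c x)) s.
Proof.
move=> dF mf fL L0 kL La Lb Lc Ls tE sE.
have Ls3 : L2 Omega (comb3 (3 / 2) a (- 2) b (1 / 2) c) by exact: L2_comb3.
have sE' : s = comb3 (3 / 2) a (- 2) b (1 / 2) c %[ae lebesgue_rV d in Omega].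
  apply: filterS2 sE tE => x sE tE Ox; rewrite (sE Ox) /comb (tE Ox) !comb3E.
  by rewrite -[in LHS]mulrA; field.
have Lf : L2 Omega (fun x => 2 * f (b x) - f (c x)).
  apply: (L2B mO); first by apply: (L2Z mO); exact: (L2_growth mf fL Lb).
  exact: (L2_growth mf fL Lc).
rewrite (ip_ae mO Ls Ls3 Ls Ls3 sE' sE') (ip_ae mO Lf Lf Ls Ls3 (aeq_refl _ _) sE').
set s3 := comb3 _ _ _ _ _ _.
have iF v : L2 Omega v -> intg Omega (F \o v) by exact: (intg_potential dF fL).
have ip1 v : ip Omega v (cst 1) = integ Omega v by apply: eq_integ => x _; rewrite mulr1.
have iFB v w : L2 Omega v -> L2 Omega w -> intg Omega (fun x => F (v x) - F (w x)).
  by move=> Lv Lw; apply: (intgB mO); exact: iF.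
have iD v w : L2 Omega v -> L2 Omega w ->
    intg Omega (fun x => comb 1 v (-1) w x * comb 1 v (-1) w x).
  by move=> Lv Lw; apply: (L2M mO); exact: (L2_comb hO).
pose Ev v w x := 3 * L * (comb 1 v (-1) w x * comb 1 v (-1) w x) + F (v x)
  + 2^-1 * (F (v x) - F (w x)).
have iE v w : L2 Omega v -> L2 Omega w -> intg Omega (Ev v w).
  move=> Lv Lw; apply: (intgD mO); last by apply: (intgZ mO); exact: iFB.
  by apply: (intgD mO); [apply: (intgZ mO); exact: iD|exact: iF].
have EE v w : L2 Omega v -> L2 Omega w ->
    3 * L * ip Omega (comb 1 v (-1) w) (comb 1 v (-1) w) + ip Omega (F \o v) (cst 1)
    + 2^-1 * ip Omega (fun x => F (v x) - F (w x)) (cst 1) = integ Omega (Ev v w).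
  move=> Lv Lw; have i1 := iD _ _ Lv Lw; have i2 := iF _ Lv; have i3 := iFB _ _ Lv Lw.
  have i6 := intgZ mO (3 * L) i1.
  rewrite !ip1 /Ev (integD mO (intgD mO i6 i2) (intgZ mO 2^-1 i3)) (integD mO i6 i2).
  by rewrite (integZ mO _ i3) (integZ mO _ i1).
have i4 : intg Omega (fun x => k * (s3 x * s3 x)) by apply: (intgZ mO); exact: (L2M mO).
have i5 : intg Omega (fun x => (2 * f (b x) - f (c x)) * s3 x) by exact: (L2M mO).
rewrite !EE// -(integB mO)//; [|exact: iE..].
rewrite /ip -(integZ mO); last exact: (L2M mO).
rewrite -(integD mO)//; apply: (le_integ mO).
- by apply: (intgB mO); exact: iE.
- exact: (intgD mO).
move=> x _; have := potential_decay (a x) (b x) (c x) dF fL L0 kL.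
rewrite /Ev /s3 comb3E /comb !mul1r !mulN1r mulNr -!expr2; exact.
Qed.

End energy_step.

Section energy_decay.
Context {R : realType} {d : nat} (Omega : set 'rV[R]_d).
Hypothesis hO : convex_polyhedral_domain Omega.

Let mO := domain_measurable hO.
Let fO := domain_finite hO.

Lemma sub_comb (v w : sfield R d) : v - w = comb 1 v (-1) w.
Proof. by apply/funext => x; rewrite /comb mul1r mulN1r. Qed.

Lemma extrapolate_comb (v w : sfield R d) : v *+ 2 - w = comb 2 v (-1) w.
Proof. by apply/funext => x; rewrite /comb mulN1r mulr2n mulrDl mul1r. Qed.

Lemma vsub_comb (v w : vfield R d) : v - w = fun i => comb 1 (v i) (-1) (w i).
Proof. by apply/funext => i; rewrite -sub_comb. Qed.

Lemma vextrapolate_comb (v w : vfield R d) : v *+ 2 - w = fun i => comb 2 (v i) (-1) (w i).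
Proof. by apply/funext => i; rewrite -extrapolate_comb !mulr2n. Qed.

Lemma quarter_norms (a b c : vfield R d) :
  (forall i, L2 Omega (a i)) -> (forall i, L2 Omega (b i)) -> (forall i, L2 Omega (c i)) ->
  4^-1 * (vL2norm Omega a ^+ 2 + vL2norm Omega b ^+ 2 + vL2norm Omega c ^+ 2) =
  \sum_i 4^-1 * (ip Omega (a i) (a i) + ip Omega (b i) (b i) + ip Omega (c i) (c i)).
Proof.
move=> La Lb Lc; rewrite !vL2normE (vipE hO La La) (vipE hO Lb Lb) (vipE hO Lc Lc).
by rewrite -!big_split mulr_sumr.
Qed.

Definition grad_energy (b a : sfield R d) i : R :=
  4^-1 * (ip Omega (grad Omega a i) (grad Omega a i)
  + ip Omega (grad Omega (a *+ 2 - b) i) (grad Omega (a *+ 2 - b) i)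
  + ip Omega (grad Omega (a - b) i) (grad Omega (a - b) i)).

Definition kinetic_energy (b a : sfield R d) : R :=
  4^-1 * (ip Omega a a
  + ip Omega (comb 2 a (-1) b) (comb 2 a (-1) b)
  + ip Omega (comb 1 a (-1) b) (comb 1 a (-1) b)).

Definition potential_energy (F : R -> R) (L : R) (b a : sfield R d) : R :=
  3 * L * ip Omega (comb 1 a (-1) b) (comb 1 a (-1) b) + ip Omega (F \o a) (cst 1)
  + 2^-1 * ip Omega (fun x => F (a x) - F (b x)) (cst 1).

Lemma energyE (F : R -> R) (L : R) (w w' : state R d) :
  H10v Omega (vel w) -> H10v Omega (vel w') ->
  energy Omega F L w w' = \sum_i grad_energy (phase w) (phase w') i
    + \sum_i kinetic_energy (vel w i) (vel w' i)
    + potential_energy F L (phase w) (phase w').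
Proof.
move=> Hw Hw'.
have Lgrad v i : L2 Omega (grad Omega v i) by exact: weak_partial_L2.
have Lw i : L2 Omega (vel w i) := (Hw i).1.1.
have Lw' i : L2 Omega (vel w' i) := (Hw' i).1.1.
have h1 := quarter_norms (Lgrad (phase w')) (Lgrad (phase w' *+ 2 - phase w))
  (Lgrad (phase w' - phase w)).
have h2 := quarter_norms Lw' (fun i => L2_comb hO 2 (-1) (Lw' i) (Lw i))
  (fun i => L2_comb hO 1 (-1) (Lw' i) (Lw i)).
have h3 := L2normE Omega (comb 1 (phase w') (-1) (phase w)).
rewrite -(vextrapolate_comb (vel w') (vel w)) -(vsub_comb (vel w') (vel w)) in h2.
rewrite -[X in L2norm _ X](sub_comb (phase w') (phase w)) in h3.
rewrite /potential_energy !addrA.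
by apply: (congr2 +%R (congr2 +%R (congr2 +%R (congr2 +%R h1 h2) (congr1 _ h3)) erefl) erefl).
Qed.

Lemma energy_balance (a b c a' b' c' p q r u : R) : a - a' <= p -> b - b' <= u ->
  c - c' <= q + r -> p + q + r + u <= 0 -> a + b + c - (a' + b' + c') <= 0.
Proof. lra. Qed.

(** The test functions are mu~, phi~ - phi^n, u~ and p~; X and C are the terms that
    cancel between the equations. *)
Lemma energy_step_le (F f : R -> R) (L S dt : R) opt (y z zt z' : state R d) :
  (forall r : R, is_derive r 1 F (f r)) -> measurable_fun setT f ->
  (forall r q, `|f r - f q| <= L * `|r - q|) -> 0 <= L ->
  0 < dt -> 3 * L <= S * dt ->
  admissible Omega y -> admissible Omega z -> euler_step Omega f S dt y z zt ->
  filter_step Omega opt y z zt z' ->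
  energy Omega F L z z' - energy Omega F L y z <= 0.
Proof.
move=> dF mf fL L0 dt0 SL Ay Az Et Ft.
have [Hz' Vz' _] := admissible_step hO Ay Az Et Ft.
have [Hy Vy dy] := Ay; have [Hz Vz dz] := Az.
have [[Ht Hm Vt Pt] eq1 eq2 eq3 eq4] := Et; have [fp _ fv _] := Ft.
have pE := unfiltered_comb3 fp.
have vE i := unfiltered_comb3 (fv i).
set s := phase zt - phase z.
have sE : s = comb 1 (phase zt) (-1) (phase z) by exact: sub_comb.
have Hs : H1 Omega s by rewrite sE; exact: (H1_comb hO 1 (-1) Ht Hz).
have {}eq1 := eq1 _ Hm; have {}eq2 := eq2 _ Hs; have {}eq3 := eq3 _ Vt.
have {}eq4 := eq4 _ Pt.
rewrite /= vextrapolate_comb in eq3.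
have Vb : H10v Omega (fun i => comb 2 (vel z i) (-1) (vel y i)).
  by move=> i; exact: (H10_comb hO 2 (-1) (Vz i) (Vy i)).
rewrite (convection_eq0 hO Vb (divergence_free_comb hO 2 (-1) Vz Vy dz dy) Vt) in eq3.
rewrite (ipC _ (pres zt)) eq4 in eq3.
rewrite /= in eq1; rewrite (ipC _ (chem zt)) -/s in eq2; rewrite -/s in eq1.
set X := ip Omega s (chem zt) in eq1 eq2.
have advE : ip Omega (advect Omega (vel zt) (phase z *+ 2 - phase y)) (chem zt) =
    vip Omega (fun i x => chem zt x * grad Omega (phase z *+ 2 - phase y) i x) (vel zt).
  apply: eq_integ => x _; rewrite /advect /vdot mulr_suml; apply: eq_bigr => i _.
  by ring.
rewrite advE in eq1; set C := vip _ _ (vel zt) in eq1 eq3.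
set V := vip _ (grad _ (chem zt)) _ in eq1.
set P := vip _ (grad _ (phase zt)) _ in eq2.
set Q := ip _ s s in eq2.
set Rr := ip _ _ s in eq2.
set U := vip _ (vel zt - vel z) _ in eq3.
set G2 := vgrad_ip _ _ _ in eq3.
have V0 : 0 <= V.
  by apply: integ_ge0 => x _; apply: sumr_ge0 => i _; rewrite -expr2 sqr_ge0.
have G20 : 0 <= G2.
  apply: integ_ge0 => x _; apply: sumr_ge0 => i _.
  by apply: sumr_ge0 => j _; rewrite -expr2 sqr_ge0.
have total : P + S * dt * Q + Rr + U <= 0.
  have -> : P + S * dt * Q + Rr + U = - (dt * (V + G2)).
    have h1 : X + dt * C + dt * V = 0.
      by rewrite -[RHS](mulr0 dt) -eq1; field; rewrite gt_eqF.
    have h3 : U + dt * G2 - dt * C = 0.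
      by rewrite -[RHS](mulr0 dt) -eq3; field; rewrite gt_eqF.
    by move: eq2 h1 h3; lra.
  by rewrite oppr_le0 mulr_ge0 ?addr_ge0// ltW.
have Lgrad v i : L2 Omega (grad Omega v i) by exact: weak_partial_L2.
have Lv (w : state R d) i : H10v Omega (vel w) -> L2 Omega (vel w i).
  by move=> Hw; exact: (Hw i).1.1.
rewrite (energyE F L Vz Vz') (energyE F L Vy Vz).
have grad_le : \sum_i grad_energy (phase z) (phase z') i - \sum_i grad_energy (phase y) (phase z) i <= P.
  rewrite -sumrB /P (vipE hO (Lgrad _) (Lgrad _)); apply: ler_sum => i _; rewrite [leRHS]ipC.
  apply: (bdf2_G_stability hO (Lgrad (phase z') i) (Lgrad (phase z) i)
    (Lgrad (phase y) i) (Lgrad (phase zt) i) (Lgrad s i) (Lgrad _ i) (Lgrad _ i)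
    (Lgrad _ i) (Lgrad _ i)).
  - have h1 := weak_partial_ae hO i Ht (H1_comb3 hO (3 / 2) (- 1) (1 / 2) Hz' Hz Hy) pE.
    have h2 := weak_partial_comb3 hO i (3 / 2) (- 1) (1 / 2) Hz' Hz Hy.
    by apply: filterS2 h1 h2 => x h1 h2 Ox; rewrite /grad (h1 Ox) (h2 Ox).
  - by rewrite /grad sE; exact: (weak_partial_comb hO i 1 (-1) Ht Hz).
  - by rewrite /grad extrapolate_comb; exact: (weak_partial_comb hO i 2 (-1) Hz' Hz).
  - by rewrite /grad sub_comb; exact: (weak_partial_comb hO i 1 (-1) Hz' Hz).
  - by rewrite /grad extrapolate_comb; exact: (weak_partial_comb hO i 2 (-1) Hz Hy).
  - by rewrite /grad sub_comb; exact: (weak_partial_comb hO i 1 (-1) Hz Hy).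
have vel_le : \sum_i kinetic_energy (vel z i) (vel z' i) - \sum_i kinetic_energy (vel y i) (vel z i) <= U.
  have Lvs i : L2 Omega (comb 1 (vel zt i) (-1) (vel z i)).
    exact: (L2_comb hO 1 (-1) (Lv zt i Vt) (Lv z i Vz)).
  rewrite -sumrB /U (vsub_comb (vel zt) (vel z)) (vipE hO Lvs (fun i => Lv zt i Vt)).
  have LC r a r' b : L2 Omega a -> L2 Omega b -> L2 Omega (comb r a r' b).
    by move=> La Lb; exact: (L2_comb hO).
  apply: ler_sum => i _.
  have [La Lb Lc] := And3 (Lv _ i Vz') (Lv _ i Vz) (Lv _ i Vy).
  apply: (bdf2_G_stability hO La Lb Lc (Lv _ i Vt) (Lvs i) (LC _ _ _ _ La Lb)
    (LC _ _ _ _ La Lb) (LC _ _ _ _ Lb Lc) (LC _ _ _ _ Lb Lc)); first exact: vE.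
  + exact: aeq_refl.
  + exact: aeq_refl.
  + exact: aeq_refl.
  + exact: aeq_refl.
  + exact: aeq_refl.
have pot_le : potential_energy F L (phase z) (phase z')
    - potential_energy F L (phase y) (phase z) <= S * dt * Q + Rr.
  apply: (potential_step hO dF mf fL L0 SL Hz'.1 Hz.1 Hy.1 Hs.1 pE).
  by rewrite sE; exact: aeq_refl.
exact: (energy_balance grad_le vel_le pot_le total).
Qed.

End energy_decay.

Theorem theorem3p1 (R : realType) (d : nat) (hd : d = 2%N \/ d = 3%N)
    (Omega : set 'rV[R]_d) (hOmega : convex_polyhedral_domain Omega)
    (K : \bar R) (hK : (1 <= K)%E)
    (F f : R -> R) (hFf : double_well K F f)
    (L : R) (hL : 0 < L) (hfL : derivative_bound f L)
    (T : R) (hT : 0 < T) (N : nat) (hN : (2 <= N)%N)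
    (S : R) (hS : 3 * L / (T / N%:R) <= S)
    (opt : pressure_option)
    (z0 z1 : state R d)
    (hz0 : starting_value Omega z0) (hz1 : starting_value Omega z1) :
  exists C0 : R,
    [/\ 0 < C0, energy Omega F L z0 z1 <= C0 &
      forall z zt : nat -> state R d,
        z 0%N = z0 -> z 1%N = z1 ->
        time_filtered_scheme Omega f S (T / N%:R) N opt z zt ->
        forall n, (1 <= n <= N - 1)%N ->
          energy Omega F L (z n) (z n.+1) - energy Omega F L (z n.-1) (z n) <= 0].
Proof.
exists (`|energy Omega F L z0 z1| + 1); split.
- by rewrite ltr_wpDl.
- by rewrite (le_trans (ler_norm _))// lerDl.
move=> z zt zz0 zz1 scheme.
have dt0 : 0 < T / N%:R by rewrite divr_gt0// ltr0n (leq_trans _ hN).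
have SL : 3 * L <= S * (T / N%:R) by rewrite -ler_pdivrMr.
have fL := derivative_bound_lip hfL.
have mf : measurable_fun setT f.
  apply: continuous_measurable_fun => s.
  by apply/differentiable_continuous/derivable1_diffP; exact: (hfL s).1.
have start w : starting_value Omega w -> admissible Omega w.
  by move=> [[Hw _ Vw _] dw]; split.
have adm n : (n < N)%N -> admissible Omega (z n) /\ admissible Omega (z n.+1).
  elim: n => [_|n IH nN]; first by rewrite zz0 zz1; split; exact: start.
  have [An An1] := IH (ltnW nN); split; first exact: An1.
  have nN1 : (1 <= n.+1 <= N - 1)%N by rewrite subn1 /= ltn_predRL.
  have [es fs] := scheme n.+1 nN1.
  exact: (admissible_step hOmega An An1 es fs).
move=> [//|n] /andP[_ nN].
have nN' : (n.+1 < N)%N by move: nN; rewrite subn1 ltn_predRL.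
have [An An1] := adm n (ltnW nN').
have [es fs] : euler_step Omega f S (T / N%:R) (z n) (z n.+1) (zt n.+2) /\
    filter_step Omega opt (z n) (z n.+1) (zt n.+2) (z n.+2).
  by apply: (scheme n.+1); rewrite nN.
exact: (energy_step_le hOmega hFf.1 mf fL (ltW hL) dt0 SL An An1 es fs).
Qed.
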